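(* $$\gamma_1\left(\tfrac14\right)-\gamma_1\left(\tfrac34\right)=-\pi\left[\gamma+4\log 2+3\log\pi-4\log\Gamma\left(\tfrac14\right)\right].$$
   Context: For real $u>0$, $\zeta(s,u)$ is the Hurwitz zeta function (the meromorphic continuation in $s$ of $\sum_{n\ge 0}(n+u)^{-s}$). The generalised Stieltjes constants $\gamma_p(u)$, $p\ge 0$, are defined by the Laurent expansion about $s=1$: $\zeta(s,u)=\frac{1}{s-1}+\sum_{p=0}^\infty\frac{(-1)^p}{p!}\gamma_p(u)(s-1)^p$. $\gamma$ is Euler's constant, $\Gamma$ the gamma function and $\log$ the natural logarithm. *)

(* Defs.v *)
From Stdlib Require Import Reals Factorial.
From Coquelicot Require Import Coquelicot.
Open Scope R_scope.

Definition Cexp (z : C) : C := (exp (Re z) * cos (Im z), exp (Re z) * sin (Im z)).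

(* a ^ s for a real base a > 0 and a complex exponent s (principal value). *)
Definition Rcpow (a : R) (s : C) : C := Cexp (Cmult s (RtoC (ln a))).

(* Z is the meromorphic continuation of sum_(n >= 0) (n + u)^(-s), whose only
   possible singularity is s = 1; the value Z 1 is irrelevant. *)
Definition is_hurwitz_zeta (u : R) (Z : C -> C) : Prop :=
  (forall s : C, 1 < Re s ->
     is_series (K := C_AbsRing) (V := C_NormedModule)
       (fun n => Rcpow (INR n + u) (Copp s)) (Z s)) /\
  (forall s : C, s <> RtoC 1 ->
     ex_derive (K := C_AbsRing) (V := C_NormedModule) Z s).

(* Laurent expansion of Z in a punctured neighbourhood of 1:
   Z s = 1 / (s - 1) + sum_(p >= 0) (-1)^p / p! * g p * (s - 1)^p. *)
Definition is_stieltjes_expansion (Z : C -> C) (g : nat -> C) : Prop :=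
  exists r : R, 0 < r /\
  forall s : C, 0 < Cmod (Cminus s (RtoC 1)) < r ->
    is_pseries (K := C_AbsRing) (V := C_NormedModule)
      (fun p => Cmult (RtoC ((-1) ^ p / INR (fact p))) (g p))
      (Cminus s (RtoC 1))
      (Cminus (Z s) (Cdiv (RtoC 1) (Cminus s (RtoC 1)))).

(* gam p u is the generalised Stieltjes constant gamma_p(u), for u > 0; as
   Laurent coefficients these are a priori complex numbers. *)
Definition are_stieltjes_constants (gam : nat -> R -> C) : Prop :=
  forall u : R, 0 < u ->
    exists Z : C -> C,
      is_hurwitz_zeta u Z /\ is_stieltjes_expansion Z (fun p => gam p u).

Definition euler_gamma : R :=
  real (Lim_seq (fun n => sum_n_m (fun k => / INR k) 1 n - ln (INR n))).

(* Euler's integral, convergent for x > 0. *)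
Definition Gamma (x : R) : R :=
  RInt_gen (fun t => Rpower t (x - 1) * exp (- t))
    (at_right 0) (Rbar_locally p_infty).

(* Main.v *)
Require Import Defs.
From Stdlib Require Import Reals.
From Coquelicot Require Import Coquelicot.
From Stdlib Require Import Lra Lia Psatz Factorial Classical.
Open Scope R_scope.

(** Along real [s = 1 + h], [h -> 0+], the poles of zeta(s, 1/4) and zeta(s, 3/4)
    cancel, so [gamma_1(1/4) - gamma_1(3/4)] is minus the slope at [h = 0] of
    [sum_n ((n + 1/4)^-s - (n + 3/4)^-s)], which reduces it to
    [S = sum_k (-1)^k ln(2k+1) / (2k+1)].

    To evaluate [S], write [ln m = Cin(m X) - ln X - gamma + O(1/(m X))], where
    [Cin x] is the integral over [[0, x]] of [(1 - cos t)/t].  Then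
    [sum_k (-1)^k Cin((2k+1) X) / (2k+1)] is the integral over [[0, X]] of
    [(q(0) - q(t))/t], with [q t = sum_k (-1)^k cos((2k+1) t) / (2k+1)] the
    Fourier series of the square wave [(PI/4) sign(cos t)].  The latter integral is
    a sum of logarithms of ratios of the jump points [PI (j + 1/2)], that is of
    [ln((i + 3/4)/(i + 1/4))], and Gauss's product for [Gamma(1/4)] together with
    Wallis's product gives its asymptotics as [X] grows. *)

(** * Integral estimates and the cosine integral *)

(** The Fourier sums of the square wave do not converge uniformly near a jump. Their primitives, the
    triangle wave sums, do converge uniformly, with error at most [1/K], and an integration by parts
    against [1/t] carries this rate to each interval between jumps, endpoints included. The two
    limits are ordered: [X] is fixed at a jump point while the number [K] of terms grows, which is
    legitimate because replacing the logarithms by [Cin] costs at most [4/X] for every [K]. Euler's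
    constant enters [Cin] through harmonic sums: the integral of [sum_k sin((2k+1) t)] over
    [[0, PI/2]] is an odd harmonic sum, and near 0 its integrand is close to the derivative of
    [Cin(2 M t) / 2]. Only [Gamma(1/4)] appears, since the product belonging to [3/4] is eliminated
    by duplication and Wallis's product, which stand in for the reflection formula. Most integrals
    are handled through primitives whose derivatives are compared. *)

(** The mean value theorem applied to [G - F]. Differentiability is asked only inside the interval,
    so that an endpoint may be singular for the derivative formula, as 0 is for [1/t]. *)
Lemma increment_le (F G f g : R -> R) (a b : R) :
  a <= b ->
  (forall t, a < t < b -> is_derive F t (f t)) ->
  (forall t, a < t < b -> is_derive G t (g t)) ->
  (forall t, a <= t <= b -> continuous F t) ->
  (forall t, a <= t <= b -> continuous G t) ->
  (forall t, a < t < b -> f t <= g t) ->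
  F b - F a <= G b - G a.
Proof.
intros Hab HF HG CF CG Hle.
destruct (Rle_lt_or_eq_dec _ _ Hab) as [Hlt|<-]; [|lra].
assert (D : forall t, a < t < b -> is_derive (fun t => G t - F t) t (g t - f t)).
{ intros t Ht; apply (is_derive_minus G F t (g t) (f t)); auto. }
assert (pr : forall c, a < c < b -> derivable_pt (fun t => G t - F t) c).
{ intros c Hc; exists (g c - f c); apply is_derive_Reals; auto. }
destruct (MVT (fun t => G t - F t) id a b pr (fun c _ => derivable_pt_id c) Hlt)
  as [c [P E]].
- intros t Ht; apply continuity_pt_filterlim, (continuous_minus G F t); auto.
- intros t _; apply derivable_continuous_pt, derivable_pt_id.
- rewrite derive_pt_id in E; unfold id in E.
  rewrite (derive_pt_eq_0 _ _ _ (pr c P) (proj1 (is_derive_Reals _ _ _) (D c P))) in E.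
  specialize (Hle c P); nra.
Qed.

Lemma increment_abs_le (F G f g : R -> R) (a b : R) :
  a <= b ->
  (forall t, a < t < b -> is_derive F t (f t)) ->
  (forall t, a < t < b -> is_derive G t (g t)) ->
  (forall t, a <= t <= b -> continuous F t) ->
  (forall t, a <= t <= b -> continuous G t) ->
  (forall t, a < t < b -> Rabs (f t) <= g t) ->
  Rabs (F b - F a) <= G b - G a.
Proof.
intros Hab HF HG CF CG Hle; apply Rabs_le; split.
- cut (- F b - - F a <= G b - G a); [lra|].
  apply (increment_le (fun t => - F t) G (fun t => - f t) g); auto.
  + intros t Ht; apply (is_derive_opp F t (f t)); auto.
  + intros t Ht; apply (continuous_opp F); auto.
  + intros t Ht; specialize (Hle t Ht); apply Rabs_le_between in Hle; lra.
- apply (increment_le F G f g); auto.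
  intros t Ht; specialize (Hle t Ht); apply Rabs_le_between in Hle; lra.
Qed.

Lemma continuous_of_derive (f : R -> R) (x l : R) : is_derive f x l -> continuous f x.
Proof. intros H; apply (ex_derive_continuous f); exists l; exact H. Qed.

(* The second mean value theorem, in the form of an integration by parts:
   [F - G u] has derivative [- G u'], whose integral is at most [B] times the
   variation of [u]. *)
Lemma oscillation_bound (F G g u u' : R -> R) (a b B : R) :
  a <= b ->
  (forall t, a <= t <= b -> is_derive F t (g t * u t)) ->
  (forall t, a <= t <= b -> is_derive G t (g t)) ->
  (forall t, a <= t <= b -> is_derive u t (u' t)) ->
  (forall t, a <= t <= b -> Rabs (G t) <= B) ->
  0 <= u a -> 0 <= u b ->
  ((forall t, a <= t <= b -> 0 <= u' t) \/ (forall t, a <= t <= b -> u' t <= 0)) ->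
  Rabs (F b - F a) <= 2 * B * Rmax (u a) (u b).
Proof.
intros Hab HF HG Hu HB Ua Ub Hs.
assert (B0 : 0 <= B).
{ apply Rle_trans with (2 := HB a ltac:(lra)), Rabs_pos. }
assert (D : forall t, a <= t <= b -> is_derive (fun t => F t - G t * u t) t (- (G t * u' t))).
{ intros t Ht.
  replace (- (G t * u' t)) with (g t * u t - (g t * u t + G t * u' t)) by ring.
  apply (is_derive_minus F (fun t => G t * u t)); [auto|].
  apply (is_derive_mult G u t (g t) (u' t)); auto; intros; apply Rmult_comm. }
assert (HGa := HB a ltac:(lra)). assert (HGb := HB b ltac:(lra)).
assert (Ga : Rabs (G a * u a) <= B * u a).
{ rewrite Rabs_mult, (Rabs_pos_eq (u a)) by lra; apply Rmult_le_compat_r; lra. }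
assert (Gb : Rabs (G b * u b) <= B * u b).
{ rewrite Rabs_mult, (Rabs_pos_eq (u b)) by lra; apply Rmult_le_compat_r; lra. }
apply Rabs_le_between in Ga, Gb.
assert (Cu : forall c t, a <= t <= b -> is_derive (fun t => c * u t) t (c * u' t)).
{ intros c t Ht; apply (is_derive_scal u t c (u' t)); auto. }
assert (M1 := Rmax_l (u a) (u b)). assert (M2 := Rmax_r (u a) (u b)).
destruct Hs as [Hs|Hs].
- assert (K : Rabs ((F b - G b * u b) - (F a - G a * u a)) <= B * u b - B * u a).
  { apply (increment_abs_le (fun t => F t - G t * u t) (fun t => B * u t)
       (fun t => - (G t * u' t)) (fun t => B * u' t)); auto.
    - intros; apply D; lra.
    - intros; apply Cu; lra.
    - intros t Ht; eapply continuous_of_derive, D, Ht.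
    - intros t Ht; eapply continuous_of_derive, Cu, Ht.
    - intros t Ht; rewrite Rabs_Ropp, Rabs_mult, (Rabs_pos_eq (u' t)).
      + apply Rmult_le_compat_r; [apply Hs|apply HB]; lra.
      + apply Hs; lra. }
  apply Rabs_le_between in K; apply Rabs_le; nra.
- assert (K : Rabs ((F b - G b * u b) - (F a - G a * u a)) <= (- B) * u b - (- B) * u a).
  { apply (increment_abs_le (fun t => F t - G t * u t) (fun t => (- B) * u t)
       (fun t => - (G t * u' t)) (fun t => (- B) * u' t)); auto.
    - intros; apply D; lra.
    - intros; apply Cu; lra.
    - intros t Ht; eapply continuous_of_derive, D, Ht.
    - intros t Ht; eapply continuous_of_derive, Cu, Ht.
    - intros t Ht; rewrite Rabs_Ropp, Rabs_mult, (Rabs_left1 (u' t)).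
      + specialize (Hs t ltac:(lra)). specialize (HB t ltac:(lra)). nra.
      + apply Hs; lra. }
  apply Rabs_le_between in K; apply Rabs_le; nra.
Qed.

Definition cosint_kernel (t : R) : R := (1 - cos t) / t.

Definition Cin (x : R) : R := RInt cosint_kernel 0 x.


Lemma one_minus_cos_le (t : R) : 0 <= 1 - cos t <= t ^ 2 / 2.
Proof.
split; [destruct (COS_bound t); lra|].
assert (P : forall x, 0 <= x -> 1 - cos x <= x ^ 2 / 2).
{ intros x Hx.
  assert (H := increment_le (fun y => - cos y) (fun y => y ^ 2 / 2) sin (fun y => y) 0 x Hx).
  cut (- cos x - - cos 0 <= x ^ 2 / 2 - 0 ^ 2 / 2); [rewrite cos_0; lra|].
  apply H.
  - intros; auto_derive; [trivial|ring].
  - intros; auto_derive; [trivial|field].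
  - intros; apply (ex_derive_continuous (fun y => - cos y)); auto_derive; trivial.
  - intros; apply (ex_derive_continuous (fun y => y ^ 2 / 2)); auto_derive; trivial.
  - intros y Hy; left; apply sin_lt_x; lra. }
destruct (Rle_dec 0 t) as [H|H]; [auto|].
rewrite <- (cos_neg t); replace (t ^ 2) with ((- t) ^ 2) by ring; apply P; lra.
Qed.

(** At 0 the formula reads [0 / 0], which evaluates to 0, the correct limit. There
    [1 - cos y <= y^2 / 2] bounds the kernel by [|y| / 2], so [eps] serves as its own modulus. *)
Lemma cosint_kernel_continuous (x : R) : continuous cosint_kernel x.
Proof.
destruct (Req_dec x 0) as [->|Hx].
- apply filterlim_locally; intros eps.
  exists eps; intros y Hy.
  change (Rabs (y - 0) < eps) in Hy.
  change (Rabs (cosint_kernel y - cosint_kernel 0) < eps).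
  unfold cosint_kernel; rewrite cos_0, Rminus_diag, Rdiv_0_l, Rminus_0_r.
  rewrite Rminus_0_r in Hy.
  destruct (Req_dec y 0) as [->|Hy0].
  + rewrite cos_0, Rminus_diag, Rdiv_0_l, Rabs_R0; apply cond_pos.
  + assert (B := one_minus_cos_le y).
    rewrite Rabs_div, Rabs_pos_eq by tauto.
    assert (P := Rabs_pos_lt y Hy0).
    apply Rmult_lt_reg_r with (Rabs y); [exact P|].
    unfold Rdiv; rewrite Rmult_assoc, Rinv_l, Rmult_1_r by lra.
    assert (Q : y ^ 2 = Rabs y * Rabs y) by (rewrite <- Rabs_mult, Rabs_pos_eq; nra).
    nra.
- apply (ex_derive_continuous cosint_kernel); unfold cosint_kernel; auto_derive; trivial.
Qed.

Lemma is_derive_Cin (x : R) : is_derive Cin x (cosint_kernel x).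
Proof.
apply (is_derive_RInt cosint_kernel Cin 0 x).
- apply filter_forall; intros y; apply (RInt_correct cosint_kernel 0 y).
  apply (ex_RInt_continuous cosint_kernel); intros; apply cosint_kernel_continuous.
- apply cosint_kernel_continuous.
Qed.

Lemma is_derive_Cin_scal (c t : R) :
  is_derive (fun y => Cin (c * y)) t (c * cosint_kernel (c * t)).
Proof.
apply (is_derive_comp Cin (fun y => c * y) t (cosint_kernel (c * t)) c).
- apply is_derive_Cin.
- auto_derive; [trivial|ring].
Qed.

Lemma Cin_0 : Cin 0 = 0.
Proof. apply (RInt_point 0 cosint_kernel). Qed.

(** The derivative of [Cin - ln] is [- cos t / t], an oscillation damped by the decreasing factor
    [1/t]. Hence [Cin - ln] has a limit at infinity, still to be identified. *)
Lemma Cin_sub_ln_cauchy (a b : R) :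
  0 < a <= b -> Rabs ((Cin b - ln b) - (Cin a - ln a)) <= 2 / a.
Proof.
intros [Ha Hab].
replace (2 / a) with (2 * 1 * Rmax (/ a) (/ b)).
2:{ rewrite Rmax_left; [field; lra|apply Rinv_le_contravar; lra]. }
apply (oscillation_bound (fun t => Cin t - ln t) (fun t => - sin t) (fun t => - cos t)
   Rinv (fun t => - / t ^ 2)); auto.
- intros t Ht.
  replace (- cos t * / t) with (cosint_kernel t - / t) by (unfold cosint_kernel; field; lra).
  apply (is_derive_minus Cin ln); [apply is_derive_Cin|].
  apply is_derive_Reals, derivable_pt_lim_ln; lra.
- intros t Ht; auto_derive; [trivial|ring].
- intros t Ht; auto_derive; [lra|field; lra].
- intros t Ht; rewrite Rabs_Ropp; apply Rabs_le, SIN_bound.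
- left; apply Rinv_0_lt_compat; lra.
- left; apply Rinv_0_lt_compat; lra.
- right; intros t Ht.
  assert (0 < / t ^ 2) by (apply Rinv_0_lt_compat; nra); lra.
Qed.

(** * Euler's constant and odd harmonic sums *)

(** A sum of exactly [n] terms, whereas [sum_n f n] has [n + 1]; inductions can start from the empty
    sum. *)
Fixpoint bsum (f : nat -> R) (n : nat) : R :=
  match n with O => 0 | S k => bsum f k + f k end.

Lemma bsum_ext (f g : nat -> R) (n : nat) :
  (forall k, (k < n)%nat -> f k = g k) -> bsum f n = bsum g n.
Proof.
induction n as [|n IH]; simpl; intros H; [reflexivity|].
rewrite IH, H by (try (intros; apply H); lia); reflexivity.
Qed.

Lemma bsum_plus (f g : nat -> R) (n : nat) :
  bsum (fun k => f k + g k) n = bsum f n + bsum g n.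
Proof. induction n as [|n IH]; simpl; [|rewrite IH]; ring. Qed.

Lemma bsum_scal (c : R) (f : nat -> R) (n : nat) :
  bsum (fun k => c * f k) n = c * bsum f n.
Proof. induction n as [|n IH]; simpl; [|rewrite IH]; ring. Qed.

Lemma is_derive_bsum (F f : nat -> R -> R) (n : nat) (x : R) :
  (forall k, is_derive (F k) x (f k x)) ->
  is_derive (fun y => bsum (fun k => F k y) n) x (bsum (fun k => f k x) n).
Proof.
intros H; induction n as [|n IH]; simpl.
- apply (is_derive_const 0 x).
- apply (is_derive_plus (fun y => bsum (fun k => F k y) n) (F n)); auto.
Qed.

Lemma ln_le_sub1 (y : R) : 0 < y -> ln y <= y - 1.
Proof. intros Hy; assert (H := exp_ineq1_le (ln y)); rewrite exp_ln in H; lra. Qed.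

Lemma INR_S_pos (n : nat) : 0 < INR (S n).
Proof. apply lt_0_INR; lia. Qed.

Lemma ln_succ_bounds (n : nat) :
  / INR (S (S n)) <= ln (INR (S (S n))) - ln (INR (S n)) <= / INR (S n).
Proof.
assert (P := INR_S_pos n). assert (Q := INR_S_pos (S n)).
assert (E : INR (S (S n)) = INR (S n) + 1) by apply S_INR.
split.
- assert (H := ln_le_sub1 (INR (S n) / INR (S (S n))) ltac:(apply Rdiv_lt_0_compat; lra)).
  rewrite ln_div in H by lra.
  replace (INR (S n) / INR (S (S n)) - 1) with (- / INR (S (S n))) in H; [lra|].
  rewrite E; field; lra.
- assert (H := ln_le_sub1 (INR (S (S n)) / INR (S n)) ltac:(apply Rdiv_lt_0_compat; lra)).
  rewrite ln_div in H by lra.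
  replace (INR (S (S n)) / INR (S n) - 1) with (/ INR (S n)) in H; [lra|].
  rewrite E; field; lra.
Qed.

(** Since [euler_gamma] is a [Lim_seq], convergence has to be supplied: the sequence decreases and
    is bounded below by 0. It is shifted by one index to avoid [ln 0]. *)
Lemma is_lim_seq_euler_gamma :
  is_lim_seq (fun n => bsum (fun k => / INR (S k)) n - ln (INR n)) euler_gamma.
Proof.
apply is_lim_seq_ext with (fun n => sum_n_m (fun k => / INR k) 1 n - ln (INR n)).
{ intros n; apply (f_equal (fun s => s - ln (INR n))).
  induction n as [|n IH]; [reflexivity|].
  rewrite sum_n_Sm by lia; rewrite IH; reflexivity. }
apply Lim_seq_correct'.
cut (ex_finite_lim_seq (fun n => sum_n_m (fun k => / INR k) 1 (S n) - ln (INR (S n)))).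
{ intros [l Hl]; exists l.
  now apply (is_lim_seq_incr_1 (fun n => sum_n_m (fun k => / INR k) 1 n - ln (INR n))). }
assert (E : forall n, sum_n_m (fun k => / INR k) 1 (S n)
          = sum_n_m (fun k => / INR k) 1 n + / INR (S n)).
{ intros n; rewrite sum_n_Sm by lia; reflexivity. }
apply ex_finite_lim_seq_decr with 0.
- intros n; rewrite (E (S n)); assert (H := ln_succ_bounds n); lra.
- assert (B : forall n, ln (INR (S n)) <= sum_n_m (fun k => / INR k) 1 n).
  { induction n as [|n IH].
    - rewrite sum_n_m_zero by lia; change (INR 1) with 1; rewrite ln_1; apply Rle_refl.
    - rewrite E; assert (H := ln_succ_bounds n); lra. }
  intros n; specialize (B n); rewrite E.
  assert (P := Rinv_0_lt_compat _ (INR_S_pos n)); lra.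
Qed.

Definition odd_harmonic (M : nat) : R := bsum (fun k => / INR (2 * k + 1)) M.

(** The even-indexed terms of the harmonic sum up to [2M] add up to half the harmonic sum up to
    [M]. *)
Lemma odd_harmonic_eq (M : nat) :
  2 * odd_harmonic M =
  2 * bsum (fun k => / INR (S k)) (2 * M) - bsum (fun k => / INR (S k)) M.
Proof.
unfold odd_harmonic; induction M as [|M IH]; [simpl; ring|].
replace (2 * S M)%nat with (S (S (2 * M))) by lia.
cbn [bsum]; rewrite Rmult_plus_distr_l, IH.
replace (2 * M + 1)%nat with (S (2 * M)) by lia.
assert (P := pos_INR M).
rewrite !S_INR, mult_INR; change (INR 2) with 2; field; lra.
Qed.

Lemma is_lim_seq_subseq_double (u : nat -> R) (l : Rbar) :
  is_lim_seq u l -> is_lim_seq (fun n => u (2 * n)%nat) l.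
Proof.
intros H; apply (is_lim_seq_subseq u l (fun n => 2 * n)%nat); [|exact H].
apply eventually_subseq; intros n; lia.
Qed.

Lemma is_lim_seq_odd_harmonic :
  is_lim_seq (fun M => 2 * odd_harmonic M - ln (INR M)) (2 * ln 2 + euler_gamma).
Proof.
apply is_lim_seq_ext_loc with
  (fun M => 2 * (bsum (fun k => / INR (S k)) (2 * M) - ln (INR (2 * M)))
   - (bsum (fun k => / INR (S k)) M - ln (INR M)) + 2 * ln 2).
{ exists 1%nat; intros M HM; rewrite odd_harmonic_eq, mult_INR, ln_mult.
  - change (INR 2) with 2; ring.
  - change (INR 2) with 2; lra.
  - apply lt_0_INR; lia. }
replace (Finite (2 * ln 2 + euler_gamma))
  with (Finite (2 * euler_gamma - euler_gamma + 2 * ln 2)) by (f_equal; ring).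
apply is_lim_seq_plus'; [apply is_lim_seq_minus'|apply is_lim_seq_const].
- apply (is_lim_seq_scal_l (fun M => bsum (fun k => / INR (S k)) (2 * M) - ln (INR (2 * M)))
   2 euler_gamma).
  apply (is_lim_seq_subseq_double _ _ is_lim_seq_euler_gamma).
- exact is_lim_seq_euler_gamma.
Qed.

(** * The constant in the asymptotics of the cosine integral *)

Lemma sum_sin_odd (M : nat) (t : R) :
  sin t * bsum (fun k => sin (INR (2 * k + 1) * t)) M = (1 - cos (2 * INR M * t)) / 2.
Proof.
induction M as [|M IH].
- simpl bsum; simpl INR; replace (2 * 0 * t) with 0 by ring; rewrite cos_0; field.
- cbn [bsum]; rewrite Rmult_plus_distr_l, IH.
  rewrite S_INR, plus_INR, mult_INR; change (INR 2) with 2; change (INR 1) with 1.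
  set (m := INR M).
  replace (2 * m * t) with ((2 * m + 1) * t - t) by ring.
  replace (2 * (m + 1) * t) with ((2 * m + 1) * t + t) by ring.
  rewrite cos_plus, cos_minus; field.
Qed.

(** The integral over [[0, t]] of [sum_k sin((2k+1) y) = (1 - cos(2 M y)) / (2 sin y)]. At [PI/2] it
    is the odd harmonic sum; near 0, where [sin y] is close to [y], it is close to
    [Cin(2 M t) / 2]. *)
Definition odd_cos_sum (M : nat) (t : R) : R :=
  bsum (fun k => (1 - cos (INR (2 * k + 1) * t)) / INR (2 * k + 1)) M.

Lemma INR_odd_pos (k : nat) : 0 < INR (2 * k + 1).
Proof. apply lt_0_INR; lia. Qed.

Lemma is_derive_odd_cos_sum (M : nat) (t : R) :
  is_derive (odd_cos_sum M) t (bsum (fun k => sin (INR (2 * k + 1) * t)) M).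
Proof.
apply (is_derive_bsum (fun k t => (1 - cos (INR (2 * k + 1) * t)) / INR (2 * k + 1))
  (fun k t => sin (INR (2 * k + 1) * t))).
intros k; generalize (INR (2 * k + 1)) (INR_odd_pos k); intros c Hc.
auto_derive; [lra|field; lra].
Qed.

Lemma odd_cos_sum_half_PI (M : nat) : odd_cos_sum M (PI / 2) = odd_harmonic M.
Proof.
apply bsum_ext; intros k _.
replace (cos (INR (2 * k + 1) * (PI / 2))) with 0; [unfold Rdiv; ring|].
rewrite plus_INR, mult_INR; change (INR 2) with 2; change (INR 1) with 1.
replace ((2 * INR k + 1) * (PI / 2)) with (INR k * PI + PI / 2) by field.
symmetry; rewrite cos_plus, cos_PI2, sin_PI2.
enough (sin (INR k * PI) = 0) by (rewrite H; ring).
apply sin_eq_0_1; exists (Z.of_nat k); rewrite <- INR_IZR_INZ; ring.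
Qed.

Lemma sin_lower (t : R) : 0 <= t -> t - t ^ 3 / 6 <= sin t.
Proof.
intros Ht.
assert (H := increment_le (fun y => y - y ^ 3 / 6) sin (fun y => 1 - y ^ 2 / 2) cos 0 t Ht).
cut ((t - t ^ 3 / 6) - (0 - 0 ^ 3 / 6) <= sin t - sin 0); [rewrite sin_0; lra|].
apply H.
- intros; auto_derive; [trivial|field].
- intros; apply is_derive_sin.
- intros; apply (ex_derive_continuous (fun y => y - y ^ 3 / 6)); auto_derive; trivial.
- intros; apply continuous_sin.
- intros y _; assert (B := one_minus_cos_le y); lra.
Qed.

Lemma cosecant_pole (t : R) : 0 < t <= 1 -> 0 <= / sin t - / t <= t.
Proof.
intros Ht.
assert (L := sin_lower t ltac:(lra)). assert (U := sin_lt_x t ltac:(lra)).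
assert (S0 : t / 2 <= sin t) by nra.
assert (E : / sin t - / t = (t - sin t) / (t * sin t)) by (field; lra).
rewrite E; split.
- apply Rdiv_le_0_compat; nra.
- apply Rmult_le_reg_r with (t * sin t); [nra|].
  unfold Rdiv; rewrite Rmult_assoc, Rinv_l, Rmult_1_r by nra.
  assert (t * (t * (t / 2)) <= t * (t * sin t)) by (repeat apply Rmult_le_compat_l; lra).
  nra.
Qed.

(* The derivative is [sin^2 (M t) (1 / sin t - 1 / t)]. *)
Lemma odd_cos_sum_near_0 (M : nat) (h : R) :
  0 < h <= 1 -> Rabs (odd_cos_sum M h - Cin (2 * INR M * h) / 2) <= h ^ 2 / 2.
Proof.
intros Hh.
assert (D : forall t, is_derive (fun t => odd_cos_sum M t - Cin (2 * INR M * t) / 2) t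
  (bsum (fun k => sin (INR (2 * k + 1) * t)) M - INR M * cosint_kernel (2 * INR M * t))).
{ intros t; apply (is_derive_minus (odd_cos_sum M) (fun t => Cin (2 * INR M * t) / 2)).
  - apply is_derive_odd_cos_sum.
  - replace (INR M * cosint_kernel (2 * INR M * t))
      with (/ 2 * (2 * INR M * cosint_kernel (2 * INR M * t))) by field.
    apply is_derive_ext with (fun t => / 2 * Cin (2 * INR M * t)).
    { intros x; apply Rmult_comm. }
    apply (is_derive_scal (fun t => Cin (2 * INR M * t))), is_derive_Cin_scal. }
assert (H := increment_abs_le (fun t => odd_cos_sum M t - Cin (2 * INR M * t) / 2)
  (fun t => t ^ 2 / 2) _ (fun t => t) 0 h ltac:(lra) (fun t _ => D t)).
replace (odd_cos_sum M h - Cin (2 * INR M * h) / 2) with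
  (odd_cos_sum M h - Cin (2 * INR M * h) / 2 - (odd_cos_sum M 0 - Cin (2 * INR M * 0) / 2)).
2:{ rewrite Rmult_0_r, Cin_0.
    replace (odd_cos_sum M 0) with 0; [field|].
    unfold odd_cos_sum; symmetry; rewrite (bsum_ext _ (fun _ => 0 * 0)).
    - rewrite bsum_scal; ring.
    - intros k _; rewrite Rmult_0_r, cos_0; unfold Rdiv; ring. }
replace (h ^ 2 / 2) with (h ^ 2 / 2 - 0 ^ 2 / 2) by field.
apply H.
- intros; auto_derive; [trivial|field].
- intros t _; eapply continuous_of_derive, D.
- intros; apply (ex_derive_continuous (fun y => y ^ 2 / 2)); auto_derive; trivial.
- intros t Ht.
  assert (L := sin_lower t ltac:(lra)). assert (S0 : 0 < sin t) by nra.
  assert (W := cosecant_pole t ltac:(lra)).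
  assert (E : bsum (fun k => sin (INR (2 * k + 1) * t)) M - INR M * cosint_kernel (2 * INR M * t)
     = (1 - cos (2 * INR M * t)) / 2 * (/ sin t - / t)).
  { assert (Q := sum_sin_odd M t).
    assert (Q2 : INR M * cosint_kernel (2 * INR M * t) = (1 - cos (2 * INR M * t)) / 2 / t).
    { unfold cosint_kernel; destruct M as [|M].
      - simpl INR; replace (2 * 0 * t) with 0 by ring; rewrite cos_0; unfold Rdiv; ring.
      - assert (P := INR_S_pos M); field; lra. }
    rewrite Q2, <- Q; field; lra. }
  rewrite E; destruct (COS_bound (2 * INR M * t)).
  apply Rabs_le; split; nra.
Qed.

(** On [[h, PI/2]] the part [1 / (2 sin t)] of the integrand has primitive [ln(tan(t/2)) / 2], with
    [tan(t/2)] written [(1 - cos t) / sin t], and vanishes at [PI/2]. The part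
    [- cos(2 M t) / (2 sin t)] oscillates with the decreasing factor [1 / sin t]. *)
Lemma odd_cos_sum_away (M : nat) (h : R) :
  (0 < M)%nat -> 0 < h <= 1 ->
  Rabs (odd_harmonic M - odd_cos_sum M h + ln ((1 - cos h) / sin h) / 2)
  <= / (2 * INR M * sin h).
Proof.
intros HM Hh.
assert (PM : 0 < INR M) by (apply lt_0_INR; lia).
assert (P2 := PI2_1).
assert (S0 : forall t, h <= t <= PI / 2 -> 0 < sin t).
{ intros t Ht; apply sin_gt_0; lra. }
assert (C1 : forall t, h <= t <= PI / 2 -> 0 < 1 - cos t).
{ intros t Ht; rewrite <- cos_0.
  assert (cos t < cos 0) by (apply cos_decreasing_1; lra); lra. }
set (F := fun t => odd_cos_sum M t - ln ((1 - cos t) / sin t) / 2).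
replace (odd_harmonic M - odd_cos_sum M h + ln ((1 - cos h) / sin h) / 2)
  with (F (PI / 2) - F h).
2:{ unfold F; rewrite odd_cos_sum_half_PI, cos_PI2, sin_PI2.
    replace ((1 - 0) / 1) with 1 by field; rewrite ln_1; field. }
assert (Hs := S0 h ltac:(lra)).
replace (/ (2 * INR M * sin h)) with (2 * / (4 * INR M) * Rmax (/ sin h) (/ sin (PI / 2))).
2:{ rewrite sin_PI2, Rinv_1, Rmax_left; [field; lra|].
    rewrite <- Rinv_1; apply Rinv_le_contravar; [lra|apply SIN_bound]. }
apply (oscillation_bound F (fun t => - sin (2 * INR M * t) / (4 * INR M))
   (fun t => - cos (2 * INR M * t) / 2) (fun t => / sin t) (fun t => - cos t / (sin t) ^ 2)).
- lra.
- intros t Ht; specialize (S0 t Ht); specialize (C1 t Ht).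
  replace (- cos (2 * INR M * t) / 2 * / sin t) with
    (bsum (fun k => sin (INR (2 * k + 1) * t)) M - / sin t / 2).
  2:{ apply Rmult_eq_reg_l with (sin t); [|lra].
      rewrite Rmult_minus_distr_l, sum_sin_odd; field; lra. }
  apply (is_derive_minus (odd_cos_sum M)); [apply is_derive_odd_cos_sum|].
  assert (E : / sin t / 2 = (sin t * sin t - (1 - cos t) * cos t) / ((1 - cos t) * sin t) / 2).
  { assert (Q := sin2_cos2 t); unfold Rsqr in Q.
    replace (sin t * sin t) with (1 - cos t * cos t) by lra; field; lra. }
  rewrite E; auto_derive; [|field; lra].
  split; [lra|]; split; [|trivial]. apply Rdiv_lt_0_compat; lra.
- intros t Ht; auto_derive; [lra|field; lra].
- intros t Ht; specialize (S0 t Ht); auto_derive; [lra|field; lra].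
- intros t Ht.
  unfold Rdiv; rewrite Rabs_mult, Rabs_Ropp, (Rabs_pos_eq (/ (4 * INR M))).
  2:{ left; apply Rinv_0_lt_compat; lra. }
  rewrite <- (Rmult_1_l (/ (4 * INR M))) at 2; apply Rmult_le_compat_r.
  + left; apply Rinv_0_lt_compat; lra.
  + apply Rabs_le, SIN_bound.
- left; apply Rinv_0_lt_compat; lra.
- rewrite sin_PI2; lra.
- right; intros t Ht; specialize (S0 t Ht).
  assert (0 <= cos t / sin t ^ 2).
  { apply Rdiv_le_0_compat; [apply cos_ge_0; lra|nra]. }
  unfold Rdiv in *; lra.
Qed.

(** With [r = tan(h/2) / (h/2)], both [r] and [1/r] are at most [1 + h^2], and [ln y <= y - 1]
    applied to each gives the two sides. *)
Lemma ln_tan_half_bound (h : R) :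
  0 < h <= 1 -> Rabs (ln ((1 - cos h) / sin h) - ln h + ln 2) <= h ^ 2.
Proof.
intros Hh.
assert (L := sin_lower h ltac:(lra)). assert (U := sin_lt_x h ltac:(lra)).
assert (S0 : 0 < sin h) by nra.
assert (C := one_minus_cos_le h). assert (C0 : 1 / 2 <= cos h) by nra.
assert (Q := sin2_cos2 h); unfold Rsqr in Q.
assert (E : (1 - cos h) / sin h = sin h / (1 + cos h)).
{ apply Rmult_eq_reg_r with (sin h * (1 + cos h)); [|nra].
  replace ((1 - cos h) / sin h * (sin h * (1 + cos h)))
    with ((1 - cos h) * (1 + cos h)) by (field; lra).
  replace (sin h / (1 + cos h) * (sin h * (1 + cos h))) with (sin h * sin h) by (field; lra).
  nra. }
set (r := 2 * sin h / (h * (1 + cos h))).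
assert (r0 : 0 < r) by (apply Rdiv_lt_0_compat; nra).
replace (ln ((1 - cos h) / sin h) - ln h + ln 2) with (ln r).
2:{ rewrite E; unfold r; rewrite !ln_div, !ln_mult by nra; ring. }
assert (A := ln_le_sub1 r r0).
assert (B := ln_le_sub1 (/ r) ltac:(now apply Rinv_0_lt_compat)).
rewrite ln_Rinv in B by exact r0.
assert (r1 : r <= 1 + h ^ 2).
{ unfold r; apply Rmult_le_reg_r with (h * (1 + cos h)); [nra|].
  unfold Rdiv; rewrite Rmult_assoc, Rinv_l, Rmult_1_r by nra.
  assert (2 * sin h <= 2 * h) by lra.
  assert (0 <= h * ((1 + h ^ 2) * (1 + cos h) - 2)); [|nra].
  apply Rmult_le_pos; [lra|]. nra. }
assert (r2 : / r <= 1 + h ^ 2).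
{ unfold r; rewrite Rinv_div; apply Rmult_le_reg_r with (2 * sin h); [nra|].
  unfold Rdiv; rewrite Rmult_assoc, Rinv_l, Rmult_1_r by nra.
  assert (h * (1 + cos h) <= 2 * h) by (destruct (COS_bound h); nra).
  assert ((1 + h ^ 2) * (2 * (h - h ^ 3 / 6)) <= (1 + h ^ 2) * (2 * sin h))
    by (apply Rmult_le_compat_l; nra).
  assert (0 <= h * ((1 + h ^ 2) * (1 - h ^ 2 / 6) - 1)); [|nra].
  apply Rmult_le_pos; [lra|]. nra. }
apply Rabs_le; lra.
Qed.

(** The interval [[0, PI/2]] is cut at [h]. After doubling, the part near 0 and the replacement of
    [tan(h/2)] by [h/2] cost [h^2] each; the part away from 0 costs [2/(M h)], and moving [Cin - ln]
    from [2 M h] to [PI M] costs [1/(M h)]. *)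
Lemma Cin_PI_odd_harmonic (M : nat) (h : R) :
  (0 < M)%nat -> 0 < h <= 1 ->
  Rabs ((Cin (PI * INR M) - ln (PI * INR M)) - (2 * odd_harmonic M - ln (INR M)) + 2 * ln 2)
  <= 2 * h + 3 / (INR M * h).
Proof.
intros HM Hh.
assert (PM : 0 < INR M) by (apply lt_0_INR; lia).
assert (P2 := PI2_1).
assert (L := sin_lower h ltac:(lra)). assert (S0 : h / 2 <= sin h) by nra.
assert (E1 := odd_cos_sum_away M h HM Hh). assert (E2 := odd_cos_sum_near_0 M h Hh).
assert (E3 := Cin_sub_ln_cauchy (2 * INR M * h) (PI * INR M) ltac:(nra)).
assert (E4 := ln_tan_half_bound h Hh).
assert (E5 : / (2 * INR M * sin h) <= / (INR M * h)).
{ apply Rinv_le_contravar; nra. }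
replace (2 / (2 * INR M * h)) with (/ (INR M * h)) in E3 by (field; lra).
rewrite !ln_mult in E3 by lra. rewrite ln_mult by lra.
unfold Rdiv at 1; set (q := / (INR M * h)) in *.
assert (h ^ 2 <= h) by nra.
apply Rabs_le_between in E1, E2, E3, E4; apply Rabs_le; lra.
Qed.

Lemma is_lim_seq_inv_INR : is_lim_seq (fun n => / INR n) 0.
Proof.
apply (is_lim_seq_inv INR p_infty); [apply is_lim_seq_INR|discriminate].
Qed.

Lemma is_lim_seq_div_INR (c : R) :
  is_lim_seq (fun K => c / INR K) 0.
Proof.
replace (Finite 0) with (Rbar_mult c 0) by (simpl; f_equal; ring).
apply (is_lim_seq_scal_l (fun K => / INR K)), is_lim_seq_inv_INR.
Qed.

Lemma is_lim_seq_sqrt_inv : is_lim_seq (fun n => sqrt (/ INR n)) 0.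
Proof.
rewrite <- sqrt_0; apply is_lim_seq_continuous; [|apply is_lim_seq_inv_INR].
apply continuity_pt_filterlim, continuous_sqrt.
Qed.

Lemma is_lim_seq_Cin_PI :
  is_lim_seq (fun M => Cin (PI * INR M) - ln (PI * INR M)) euler_gamma.
Proof.
set (d := fun M => (Cin (PI * INR M) - ln (PI * INR M))
   - (2 * odd_harmonic M - ln (INR M)) + 2 * ln 2).
apply is_lim_seq_ext with (fun M => d M + (2 * odd_harmonic M - ln (INR M)) - 2 * ln 2).
{ intros M; unfold d; ring. }
replace (Finite euler_gamma) with (Finite (0 + (2 * ln 2 + euler_gamma) - 2 * ln 2))
  by (f_equal; ring).
apply is_lim_seq_minus'; [apply is_lim_seq_plus'|apply is_lim_seq_const].
2: exact is_lim_seq_odd_harmonic.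
apply is_lim_seq_abs_0.
(* The cut [h = 1 / sqrt M] balances [2 h] against [3/(M h)], giving [5 / sqrt M]. *)
apply is_lim_seq_le_le_loc with (fun _ => 0) (fun M => 5 * sqrt (/ INR M)).
- exists 1%nat; intros M HM; split; [apply Rabs_pos|].
  assert (PM : 1 <= INR M) by (apply (le_INR 1); lia).
  assert (I0 : 0 < / INR M <= 1).
  { split; [apply Rinv_0_lt_compat; lra|rewrite <- Rinv_1; apply Rinv_le_contravar; lra]. }
  assert (s0 := sqrt_lt_R0 _ (proj1 I0)). assert (s2 := sqrt_sqrt (/ INR M) ltac:(lra)).
  assert (s1 : sqrt (/ INR M) <= 1) by (rewrite <- sqrt_1; apply sqrt_le_1; lra).
  assert (B := Cin_PI_odd_harmonic M (sqrt (/ INR M)) ltac:(lia) ltac:(lra)).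
  fold (d M) in B; set (s := sqrt (/ INR M)) in *.
  replace (3 / (INR M * s)) with (3 * s) in B; [lra|].
  replace (INR M) with (/ (s * s)) by (rewrite s2; field; lra).
  field; lra.
- apply is_lim_seq_const.
- replace (Finite 0) with (Rbar_mult 5 0) by (simpl; f_equal; ring).
  apply is_lim_seq_scal_l, is_lim_seq_sqrt_inv.
Qed.

(** The limit along [PI M] identifies the constant; the Cauchy estimate between [x] and [PI M], with
    [M] tending to infinity, extends it to all real [x] with a rate. *)
Lemma Cin_asymptotics (x : R) : 0 < x -> Rabs (Cin x - ln x - euler_gamma) <= 2 / x.
Proof.
intros Hx.
assert (H : is_lim_seq (fun M => Rabs ((Cin (PI * INR M) - ln (PI * INR M)) - (Cin x - ln x)))
  (Rabs (euler_gamma - (Cin x - ln x)))).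
{ apply (is_lim_seq_abs _ (Finite (euler_gamma - (Cin x - ln x)))).
  apply is_lim_seq_minus'; [apply is_lim_seq_Cin_PI|apply is_lim_seq_const]. }
rewrite Rabs_minus_sym.
apply (is_lim_seq_le_loc _ (fun _ => 2 / x) (Rabs (euler_gamma - (Cin x - ln x))) (2 / x)
  ) with (2 := H) (3 := is_lim_seq_const _).
destruct (nfloor_ex x) as [n Hn]; [lra|].
exists (S n); intros M HM; apply Cin_sub_ln_cauchy.
apply le_INR in HM; rewrite S_INR in HM; assert (P2 := PI2_1).
assert (0 <= INR M) by apply pos_INR; nra.
Qed.

(** * Fourier sums of the square and triangle waves *)

Definition square_wave_sum (K : nat) (t : R) : R :=
  bsum (fun k => (-1) ^ k * (cos (INR (2 * k + 1) * t) / INR (2 * k + 1))) K.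

(** The primitive of [square_wave_sum] that vanishes at 0. Its coefficients are summable, hence
    uniform convergence even across the jumps. *)
Definition triangle_wave_sum (K : nat) (t : R) : R :=
  bsum (fun k => (-1) ^ k * (sin (INR (2 * k + 1) * t) / INR (2 * k + 1) ^ 2)) K.

Definition Cin_sum (K : nat) (t : R) : R :=
  bsum (fun k => (-1) ^ k * (Cin (INR (2 * k + 1) * t) / INR (2 * k + 1))) K.

Lemma Rabs_pow_m1 (k : nat) : Rabs ((-1) ^ k) = 1.
Proof. apply pow_1_abs. Qed.

(** Telescoping: [2 cos t sin((2k+1) t) = sin(2 k t) + sin((2k+2) t)], and the signs alternate. *)
Lemma sum_sin_odd_alternating (K : nat) (t : R) :
  2 * cos t * bsum (fun k => (-1) ^ k * sin (INR (2 * k + 1) * t)) K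
  = - ((-1) ^ K * sin (2 * INR K * t)).
Proof.
induction K as [|K IH].
- simpl bsum; simpl INR; replace (2 * 0 * t) with 0 by ring; rewrite sin_0; ring.
- cbn [bsum]; rewrite Rmult_plus_distr_l, IH.
  rewrite S_INR, plus_INR, mult_INR; change (INR 2) with 2; change (INR 1) with 1.
  set (m := INR K).
  replace (2 * m * t) with ((2 * m + 1) * t - t) by ring.
  replace (2 * (m + 1) * t) with ((2 * m + 1) * t + t) by ring.
  rewrite sin_plus, sin_minus; simpl pow; ring.
Qed.

Lemma is_derive_square_wave_sum (K : nat) (t : R) :
  is_derive (square_wave_sum K) t
    (- bsum (fun k => (-1) ^ k * sin (INR (2 * k + 1) * t)) K).
Proof.
replace (- bsum (fun k => (-1) ^ k * sin (INR (2 * k + 1) * t)) K)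
  with (bsum (fun k => -1 * ((-1) ^ k * sin (INR (2 * k + 1) * t))) K)
  by (rewrite bsum_scal; ring).
apply (is_derive_bsum (fun k t => (-1) ^ k * (cos (INR (2 * k + 1) * t) / INR (2 * k + 1)))
  (fun k t => -1 * ((-1) ^ k * sin (INR (2 * k + 1) * t)))).
intros k; generalize ((-1) ^ k) (INR (2 * k + 1)) (INR_odd_pos k); intros s c Hc.
auto_derive; [lra|field; lra].
Qed.

Lemma is_derive_triangle_wave_sum (K : nat) (t : R) :
  is_derive (triangle_wave_sum K) t (square_wave_sum K t).
Proof.
apply (is_derive_bsum (fun k t => (-1) ^ k * (sin (INR (2 * k + 1) * t) / INR (2 * k + 1) ^ 2))
  (fun k t => (-1) ^ k * (cos (INR (2 * k + 1) * t) / INR (2 * k + 1)))).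
intros k; generalize ((-1) ^ k) (INR (2 * k + 1)) (INR_odd_pos k); intros s c Hc.
auto_derive; [lra|field; lra].
Qed.

Lemma is_derive_Cin_sum_kernel (K : nat) (t : R) :
  is_derive (Cin_sum K) t (bsum (fun k => (-1) ^ k * cosint_kernel (INR (2 * k + 1) * t)) K).
Proof.
apply (is_derive_bsum (fun k t => (-1) ^ k * (Cin (INR (2 * k + 1) * t) / INR (2 * k + 1)))
  (fun k t => (-1) ^ k * cosint_kernel (INR (2 * k + 1) * t))).
intros k; generalize ((-1) ^ k) (INR (2 * k + 1)) (INR_odd_pos k); intros s c Hc.
replace (s * cosint_kernel (c * t)) with (s / c * (c * cosint_kernel (c * t)))
  by (field; lra).
apply is_derive_ext with (fun y => s / c * Cin (c * y)).
{ intros y; change (s / c * Cin (c * y) = s * (Cin (c * y) / c)); field; lra. }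
apply (is_derive_scal (fun y => Cin (c * y))), is_derive_Cin_scal.
Qed.

Lemma is_derive_Cin_sum (K : nat) (t : R) : t <> 0 ->
  is_derive (Cin_sum K) t ((square_wave_sum K 0 - square_wave_sum K t) / t).
Proof.
intros Ht.
replace ((square_wave_sum K 0 - square_wave_sum K t) / t)
  with (bsum (fun k => (-1) ^ k * cosint_kernel (INR (2 * k + 1) * t)) K).
2:{ unfold square_wave_sum; apply Rmult_eq_reg_l with t; [|exact Ht].
    rewrite <- bsum_scal.
    replace (t * ((bsum (fun k => (-1) ^ k * (cos (INR (2 * k + 1) * 0) / INR (2 * k + 1))) K
     - bsum (fun k => (-1) ^ k * (cos (INR (2 * k + 1) * t) / INR (2 * k + 1))) K) / t))
    with (bsum (fun k => (-1) ^ k * (cos (INR (2 * k + 1) * 0) / INR (2 * k + 1))) K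
     + -1 * bsum (fun k => (-1) ^ k * (cos (INR (2 * k + 1) * t) / INR (2 * k + 1))) K)
    by (field; exact Ht).
    rewrite <- bsum_scal, <- bsum_plus.
    apply bsum_ext; intros k _; unfold cosint_kernel.
    rewrite Rmult_0_r, cos_0; assert (P := INR_odd_pos k); field; lra. }
apply is_derive_Cin_sum_kernel.
Qed.

Lemma Cin_sum_0 (K : nat) : Cin_sum K 0 = 0.
Proof.
unfold Cin_sum; rewrite (bsum_ext _ (fun _ => 0 * 0)).
- rewrite bsum_scal; ring.
- intros k _; rewrite Rmult_0_r, Cin_0; unfold Rdiv; ring.
Qed.

Lemma Cin_sum_continuous (K : nat) (t : R) : continuous (Cin_sum K) t.
Proof. eapply continuous_of_derive, is_derive_Cin_sum_kernel. Qed.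

Lemma square_wave_sum_slope (K : nat) (t : R) : 0 < cos t ->
  - bsum (fun k => (-1) ^ k * sin (INR (2 * k + 1) * t)) K
  = (-1) ^ K * sin (2 * INR K * t) * / (2 * cos t).
Proof.
intros Ct; apply Rmult_eq_reg_l with (2 * cos t); [|lra].
rewrite Ropp_mult_distr_r_reverse, sum_sin_odd_alternating; field; lra.
Qed.

(** The slope is [sin(2 K t) / (2 cos t)] up to sign, an oscillation with an increasing factor, so
    its integral is of order [1/K]. The bound degenerates at the jump [PI/2], where [cos t]
    vanishes. *)
Lemma square_wave_sum_flat (K : nat) (t : R) :
  (0 < K)%nat -> 0 <= t < PI / 2 ->
  Rabs (square_wave_sum K t - square_wave_sum K 0) <= / (2 * INR K * cos t).
Proof.
intros HK Ht.
assert (PK : 0 < INR K) by (apply lt_0_INR; lia).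
assert (C0 : forall y, 0 <= y <= t -> 0 < cos y) by (intros; apply cos_gt_0; lra).
assert (Ct := C0 t ltac:(lra)).
replace (/ (2 * INR K * cos t)) with
  (2 * / (2 * INR K) * Rmax (/ (2 * cos 0)) (/ (2 * cos t))).
2:{ rewrite cos_0, Rmax_right; [field; lra|].
    apply Rinv_le_contravar; [lra|]; destruct (COS_bound t); lra. }
apply (oscillation_bound (square_wave_sum K)
   (fun y => - ((-1) ^ K * cos (2 * INR K * y)) / (2 * INR K))
   (fun y => (-1) ^ K * sin (2 * INR K * y)) (fun y => / (2 * cos y))
   (fun y => sin y / (2 * (cos y) ^ 2))).
- lra.
- intros y Hy; rewrite <- square_wave_sum_slope by auto; apply is_derive_square_wave_sum.
- intros y Hy; generalize ((-1) ^ K); intros s; auto_derive; [lra|field; lra].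
- intros y Hy; specialize (C0 y Hy); auto_derive; [lra|field; lra].
- intros y Hy; unfold Rdiv; rewrite Rabs_mult, Rabs_Ropp, Rabs_mult, Rabs_pow_m1, Rmult_1_l.
  rewrite (Rabs_pos_eq (/ _)) by (left; apply Rinv_0_lt_compat; lra).
  rewrite <- (Rmult_1_l (/ (2 * INR K))) at 2; apply Rmult_le_compat_r.
  + left; apply Rinv_0_lt_compat; lra.
  + apply Rabs_le, COS_bound.
- rewrite cos_0; lra.
- left; apply Rinv_0_lt_compat; lra.
- left; intros y Hy; specialize (C0 y Hy).
  apply Rdiv_le_0_compat; [apply sin_ge_0; lra|nra].
Qed.

(** The slope is at most [1 / (2 cos y) <= 1], because [cos y >= 1/2] on [[0, 1]]. The constant does
    not depend on [K], which tames the factor [1/t] near 0. *)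
Lemma square_wave_sum_lipschitz (K : nat) (t : R) :
  0 <= t <= 1 -> Rabs (square_wave_sum K t - square_wave_sum K 0) <= t.
Proof.
intros Ht.
replace t with (t - 0) at 2 by ring.
apply (increment_abs_le (square_wave_sum K) (fun y => y) 
  (fun y => - bsum (fun k => (-1) ^ k * sin (INR (2 * k + 1) * y)) K) (fun _ => 1)).
- lra.
- intros; apply is_derive_square_wave_sum.
- intros; apply (is_derive_id (K := R_AbsRing)).
- intros; eapply continuous_of_derive, is_derive_square_wave_sum.
- intros; apply continuous_id.
- intros y Hy.
  assert (C := one_minus_cos_le y). assert (C0 : 1 / 2 <= cos y) by nra.
  rewrite square_wave_sum_slope by lra.
  rewrite !Rabs_mult, Rabs_pow_m1, Rmult_1_l.
  rewrite (Rabs_pos_eq (/ _)) by (left; apply Rinv_0_lt_compat; lra).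
  assert (B : Rabs (sin (2 * INR K * y)) <= 1) by apply Rabs_le, SIN_bound.
  assert (D : / (2 * cos y) <= 1).
  { rewrite <- Rinv_1; apply Rinv_le_contravar; lra. }
  assert (0 < / (2 * cos y)) by (apply Rinv_0_lt_compat; lra).
  assert (P := Rabs_pos (sin (2 * INR K * y))); nra.
Qed.

(** At 0 the sums are those of Leibniz's series, and [Alt_PI] is four times its limit. This one
    value fixes the height of the whole square wave. *)
Lemma is_lim_seq_leibniz : is_lim_seq (fun K => square_wave_sum K 0) (PI / 4).
Proof.
rewrite <- Alt_PI_eq; unfold Alt_PI; destruct exist_PI as [a Ha].
replace (4 * a / 4) with a by field.
apply is_lim_seq_incr_1, is_lim_seq_Reals.
apply Un_cv_ext with (2 := Ha); intros K.
assert (E : forall k, tg_alt PI_tg k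
   = (-1) ^ k * (cos (INR (2 * k + 1) * 0) / INR (2 * k + 1))).
{ intros k; rewrite Rmult_0_r, cos_0; unfold tg_alt, PI_tg, Rdiv; ring. }
induction K as [|K IH].
- simpl sum_f_R0; unfold square_wave_sum; simpl bsum; rewrite E; simpl; ring.
- simpl sum_f_R0; rewrite IH, E; reflexivity.
Qed.

(** Integration of the flatness estimate from 0 to [t]: the slope of the difference is at most
    [1 / (2 K cos t)] on that interval. *)
Lemma is_lim_seq_triangle_wave (t : R) : 0 <= t < PI / 2 ->
  is_lim_seq (fun K => triangle_wave_sum K t) (PI / 4 * t).
Proof.
intros Ht.
assert (Ct : 0 < cos t) by (apply cos_gt_0; lra).
apply is_lim_seq_ext with
  (fun K => (triangle_wave_sum K t - square_wave_sum K 0 * t) + square_wave_sum K 0 * t).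
{ intros K; ring. }
replace (Finite (PI / 4 * t)) with (Finite (0 + PI / 4 * t)) by (f_equal; ring).
apply is_lim_seq_plus'.
2:{ apply (is_lim_seq_scal_r _ t (PI / 4)), is_lim_seq_leibniz. }
apply is_lim_seq_abs_0.
apply is_lim_seq_le_le_loc with (fun _ => 0) (fun K => t / (2 * cos t) * / INR K).
- exists 1%nat; intros K HK; split; [apply Rabs_pos|].
  assert (PK : 0 < INR K) by (apply lt_0_INR; lia).
  set (c := / (2 * INR K * cos t)).
  assert (H := increment_abs_le (fun y => triangle_wave_sum K y - square_wave_sum K 0 * y)
    (fun y => c * y) (fun y => square_wave_sum K y - square_wave_sum K 0) (fun _ => c)
    0 t ltac:(lra)).
  replace (t / (2 * cos t) * / INR K) with (c * t - c * 0) by (unfold c; field; lra).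
  replace (triangle_wave_sum K t - square_wave_sum K 0 * t)
    with (triangle_wave_sum K t - square_wave_sum K 0 * t
          - (triangle_wave_sum K 0 - square_wave_sum K 0 * 0)).
  2:{ replace (triangle_wave_sum K 0) with 0; [ring|].
      unfold triangle_wave_sum; symmetry; rewrite (bsum_ext _ (fun _ => 0 * 0)).
      - rewrite bsum_scal; ring.
      - intros k _; rewrite Rmult_0_r, sin_0; unfold Rdiv; ring. }
  assert (D : forall y, is_derive (fun y => triangle_wave_sum K y - square_wave_sum K 0 * y) y
     (square_wave_sum K y - square_wave_sum K 0)).
  { intros y; apply (is_derive_minus (triangle_wave_sum K)).
    - apply is_derive_triangle_wave_sum.
    - auto_derive; [trivial|ring]. }
  apply H.
  + intros; apply D.
  + intros; auto_derive; [trivial|ring].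
  + intros; eapply continuous_of_derive, D.
  + intros; apply (ex_derive_continuous (fun y => c * y)); auto_derive; trivial.
  + intros y Hy; eapply Rle_trans; [apply square_wave_sum_flat; [lia|lra]|].
    unfold c; apply Rinv_le_contravar; [nra|].
    apply Rmult_le_compat_l; [lra|]. apply cos_decr_1; lra.
- apply is_lim_seq_const.
- replace (Finite 0) with (Rbar_mult (t / (2 * cos t)) 0) by (simpl; f_equal; ring).
  apply is_lim_seq_scal_l, is_lim_seq_inv_INR.
Qed.

(** Each term is at most [1/(2m+1)^2 <= 1/m - 1/(m+1)], so the bound telescopes, uniformly in
    [t]. *)
Lemma triangle_wave_sum_tail (K n : nat) (t : R) : (0 < K)%nat ->
  Rabs (triangle_wave_sum (K + n) t - triangle_wave_sum K t) <= / INR K - / INR (K + n).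
Proof.
intros HK; induction n as [|n IH].
- rewrite Nat.add_0_r, !Rminus_diag, Rabs_R0; apply Rle_refl.
- replace (K + S n)%nat with (S (K + n)) by lia.
  unfold triangle_wave_sum in *; cbn [bsum].
  set (m := (K + n)%nat) in *.
  assert (Pm : 1 <= INR m) by (apply (le_INR 1); lia).
  assert (T : Rabs ((-1) ^ m * (sin (INR (2 * m + 1) * t) / INR (2 * m + 1) ^ 2))
     <= / INR m - / INR (S m)).
  { rewrite Rabs_mult, Rabs_pow_m1, Rmult_1_l, plus_INR, mult_INR, (S_INR m).
    change (INR 2) with 2; change (INR 1) with 1.
    unfold Rdiv; rewrite Rabs_mult, (Rabs_pos_eq (/ _)).
    2:{ left; apply Rinv_0_lt_compat; nra. }
    assert (B : Rabs (sin ((2 * INR m + 1) * t)) <= 1) by apply Rabs_le, SIN_bound.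
    replace (/ INR m - / (INR m + 1)) with (/ (INR m * (INR m + 1))) by (field; lra).
    apply Rle_trans with (1 * / (2 * INR m + 1) ^ 2).
    - apply Rmult_le_compat_r; [|exact B]. left; apply Rinv_0_lt_compat; nra.
    - rewrite Rmult_1_l; apply Rinv_le_contravar; nra. }
  apply Rabs_le_between in T, IH; apply Rabs_le; lra.
Qed.

Lemma triangle_wave_sum_error_open (K : nat) (t : R) : (0 < K)%nat -> 0 <= t < PI / 2 ->
  Rabs (triangle_wave_sum K t - PI / 4 * t) <= / INR K.
Proof.
intros HK Ht.
rewrite Rabs_minus_sym.
apply (is_lim_seq_le_loc (fun L => Rabs (triangle_wave_sum L t - triangle_wave_sum K t))
   (fun _ => / INR K) (Rabs (PI / 4 * t - triangle_wave_sum K t)) (/ INR K)).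
- exists K; intros L HL.
  replace L with (K + (L - K))%nat by lia.
  eapply Rle_trans; [apply triangle_wave_sum_tail, HK|].
  assert (0 < / INR (K + (L - K))) by (apply Rinv_0_lt_compat, lt_0_INR; lia); lra.
- apply (is_lim_seq_abs _ (Finite (PI / 4 * t - triangle_wave_sum K t))).
  apply is_lim_seq_minus'; [now apply is_lim_seq_triangle_wave|apply is_lim_seq_const].
- apply is_lim_seq_const.
Qed.

(** The endpoint [PI/2] is reached by continuity in [t] for fixed [K], and negative [t] by oddness.
    Including the endpoints lets consecutive intervals between jumps be glued. *)
Lemma triangle_wave_sum_error (K : nat) (t : R) : (0 < K)%nat -> - (PI / 2) <= t <= PI / 2 ->
  Rabs (triangle_wave_sum K t - PI / 4 * t) <= / INR K.
Proof.
intros HK.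
assert (P2 := PI2_1).
assert (P : forall y, 0 <= y <= PI / 2 -> Rabs (triangle_wave_sum K y - PI / 4 * y) <= / INR K).
{ intros y Hy.
  (* For [n >= 1] and [y > 0] these points lie in [[0, y)], within the range of the open
     estimate. *)
  set (yn := fun n => y - y * / INR n).
  assert (Ly : is_lim_seq yn y).
  { replace (Finite y) with (Finite (y - y * 0)) by (f_equal; ring).
    apply is_lim_seq_minus'; [apply is_lim_seq_const|].
    apply (is_lim_seq_scal_l _ y 0), is_lim_seq_inv_INR. }
  assert (C : continuous (fun y => Rabs (triangle_wave_sum K y - PI / 4 * y)) y).
  { apply (continuous_comp (fun y => triangle_wave_sum K y - PI / 4 * y) Rabs).
    - apply (continuous_minus (triangle_wave_sum K)).
      + eapply continuous_of_derive, is_derive_triangle_wave_sum.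
      + apply (ex_derive_continuous (fun y => PI / 4 * y)); auto_derive; trivial.
    - apply continuous_Rabs. }
  assert (L : is_lim_seq (fun n => Rabs (triangle_wave_sum K (yn n) - PI / 4 * yn n))
     (Rabs (triangle_wave_sum K y - PI / 4 * y))).
  { apply (is_lim_seq_continuous (fun y => Rabs (triangle_wave_sum K y - PI / 4 * y)) yn y);
    [|exact Ly].
    apply continuity_pt_filterlim, C. }
  apply (is_lim_seq_le_loc _ (fun _ => / INR K) (Rabs (triangle_wave_sum K y - PI / 4 * y))
    (/ INR K)) with (2 := L) (3 := is_lim_seq_const _).
  exists 1%nat; intros n Hn; apply triangle_wave_sum_error_open; [exact HK|].
  unfold yn.
  assert (1 <= INR n) by (apply (le_INR 1); lia).
  assert (0 < / INR n) by (apply Rinv_0_lt_compat; lra).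
  assert (/ INR n <= 1) by (rewrite <- Rinv_1; apply Rinv_le_contravar; lra).
  destruct (Req_dec y 0) as [->|Hy0]; [lra|nra]. }
intros Ht; destruct (Rle_dec 0 t) as [H|H]; [apply P; lra|].
replace (triangle_wave_sum K t - PI / 4 * t)
  with (- (triangle_wave_sum K (- t) - PI / 4 * (- t))).
- rewrite Rabs_Ropp; apply P; lra.
- replace (triangle_wave_sum K (- t)) with (- triangle_wave_sum K t); [ring|].
  replace (- triangle_wave_sum K t) with (-1 * triangle_wave_sum K t) by ring.
  unfold triangle_wave_sum; rewrite <- bsum_scal.
  apply bsum_ext; intros k _.
  rewrite Ropp_mult_distr_r_reverse, sin_neg; unfold Rdiv; ring.
Qed.

Lemma triangle_wave_sum_shift (K j : nat) (t : R) :
  triangle_wave_sum K (t + INR j * PI) = (-1) ^ j * triangle_wave_sum K t.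
Proof.
induction j as [|j IH].
- simpl; rewrite Rmult_0_l, Rplus_0_r; ring.
- simpl pow; rewrite Rmult_assoc, <- IH, S_INR.
  replace (t + (INR j + 1) * PI) with (t + INR j * PI + PI) by ring.
  set (y := t + INR j * PI).
  unfold triangle_wave_sum; rewrite <- bsum_scal; apply bsum_ext; intros k _.
  replace (INR (2 * k + 1) * (y + PI)) with (INR (2 * k + 1) * y + PI + 2 * INR k * PI).
  2:{ rewrite plus_INR, mult_INR; change (INR 2) with 2; change (INR 1) with 1; ring. }
  rewrite sin_period, neg_sin; unfold Rdiv; ring.
Qed.

(** * Evaluation of the alternating logarithmic series *)

(** On this interval the square wave has the constant value [c = (PI/4) (-1)^j], and [e] is the
    uniformly small primitive of [square_wave_sum K - c]. Integrating [e' / t] by parts leaves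
    boundary terms at most [1/(K a) + 1/(K b)] and an integral of [e / t^2] at most
    [1/(K a) - 1/(K b)], in total [2/(K a)]. *)
Lemma Cin_sum_piece (K j : nat) (a b : R) :
  (0 < K)%nat -> 0 < a <= b -> INR j * PI - PI / 2 <= a -> b <= INR j * PI + PI / 2 ->
  Rabs (Cin_sum K b - Cin_sum K a
        - (square_wave_sum K 0 - PI / 4 * (-1) ^ j) * (ln b - ln a)) <= 2 / (INR K * a).
Proof.
intros HK Hab Ha Hb.
assert (PK : 0 < INR K) by (apply lt_0_INR; lia).
set (c := PI / 4 * (-1) ^ j). set (q0 := square_wave_sum K 0).
set (e := fun t => triangle_wave_sum K t - c * (t - INR j * PI)).
assert (Be : forall t, a <= t <= b -> Rabs (e t) <= / INR K).
{ intros t Ht.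
  assert (E := triangle_wave_sum_shift K j (t - INR j * PI)).
  replace (t - INR j * PI + INR j * PI) with t in E by ring.
  unfold e, c; rewrite E.
  replace ((-1) ^ j * triangle_wave_sum K (t - INR j * PI) -
    PI / 4 * (-1) ^ j * (t - INR j * PI)) with ((-1) ^ j *
    (triangle_wave_sum K (t - INR j * PI) - PI / 4 * (t - INR j * PI))) by ring.
  rewrite Rabs_mult, Rabs_pow_m1, Rmult_1_l.
  apply triangle_wave_sum_error; [exact HK|lra]. }
assert (De : forall t, is_derive e t (square_wave_sum K t - c)).
{ intros t; apply (is_derive_minus (triangle_wave_sum K)).
  - apply is_derive_triangle_wave_sum.
  - auto_derive; [trivial|ring]. }
assert (D : forall t, a <= t <= b ->
  is_derive (fun t => (Cin_sum K t - (q0 - c) * ln t) + e t * / t) t (- e t / t ^ 2)).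
{ intros t Ht.
  replace (- e t / t ^ 2) with (((q0 - square_wave_sum K t) / t - (q0 - c) * / t)
     + ((square_wave_sum K t - c) * / t + e t * (- / t ^ 2))) by (field; lra).
  apply (is_derive_plus (fun t => Cin_sum K t - (q0 - c) * ln t) (fun t => e t * / t)).
  - apply (is_derive_minus (Cin_sum K) (fun t => (q0 - c) * ln t)).
    + apply is_derive_Cin_sum; lra.
    + auto_derive; [lra|field; lra].
  - apply (is_derive_mult e Rinv t (square_wave_sum K t - c) (- / t ^ 2)).
    + apply De.
    + auto_derive; [lra|field; lra].
    + intros; apply Rmult_comm. }
assert (G : forall t, a <= t <= b -> is_derive (fun t => - / INR K * / t) t (/ INR K * / t ^ 2)).
{ intros t Ht; auto_derive; [lra|field; lra]. }
assert (H := increment_abs_le _ _ _ _ a b (proj2 Hab)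
  (fun t Ht => D t (conj (Rlt_le _ _ (proj1 Ht)) (Rlt_le _ _ (proj2 Ht))))
  (fun t Ht => G t (conj (Rlt_le _ _ (proj1 Ht)) (Rlt_le _ _ (proj2 Ht))))
  (fun t Ht => continuous_of_derive _ _ _ (D t Ht))
  (fun t Ht => continuous_of_derive _ _ _ (G t Ht))).
assert (B : forall t, a <= t <= b -> Rabs (e t * / t) <= / INR K * / t).
{ intros t Ht; rewrite Rabs_mult, (Rabs_pos_eq (/ t)) by (left; apply Rinv_0_lt_compat; lra).
  apply Rmult_le_compat_r; [left; apply Rinv_0_lt_compat; lra|auto]. }
assert (Ba := B a ltac:(lra)). assert (Bb := B b ltac:(lra)).
replace (2 / (INR K * a)) with (2 * (/ INR K * / a)) by (field; lra).
lapply H; clear H.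
- intros H; apply Rabs_le_between in H, Ba, Bb; apply Rabs_le; lra.
- intros t Ht; unfold Rdiv; rewrite Rabs_mult, Rabs_Ropp.
  rewrite (Rabs_pos_eq (/ _)) by (left; apply Rinv_0_lt_compat; nra).
  apply Rmult_le_compat_r; [left; apply Rinv_0_lt_compat; nra|apply Be; lra].
Qed.

Lemma is_lim_seq_Cin_sum_piece (j : nat) (a b : R) :
  0 < a <= b -> INR j * PI - PI / 2 <= a -> b <= INR j * PI + PI / 2 ->
  is_lim_seq (fun K => Cin_sum K b - Cin_sum K a)
    (PI / 4 * (1 - (-1) ^ j) * (ln b - ln a)).
Proof.
intros Hab Ha Hb.
apply is_lim_seq_ext with (fun K => (Cin_sum K b - Cin_sum K a
   - (square_wave_sum K 0 - PI / 4 * (-1) ^ j) * (ln b - ln a))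
   + (square_wave_sum K 0 - PI / 4 * (-1) ^ j) * (ln b - ln a)).
{ intros K; ring. }
replace (PI / 4 * (1 - (-1) ^ j) * (ln b - ln a)) with
  (0 + (PI / 4 - PI / 4 * (-1) ^ j) * (ln b - ln a)) by ring.
apply is_lim_seq_plus'.
- apply is_lim_seq_abs_0.
  apply is_lim_seq_le_le_loc with (fun _ => 0) (fun K => (2 / a) / INR K).
  + exists 1%nat; intros K HK; split; [apply Rabs_pos|].
    assert (PK : 0 < INR K) by (apply lt_0_INR; lia).
    replace (2 / a / INR K) with (2 / (INR K * a)) by (field; lra).
    apply Cin_sum_piece; auto.
  + apply is_lim_seq_const.
  + apply is_lim_seq_div_INR.
- apply (is_lim_seq_scal_r _ (ln b - ln a) (PI / 4 - PI / 4 * (-1) ^ j)).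
  apply is_lim_seq_minus'; [apply is_lim_seq_leibniz|apply is_lim_seq_const].
Qed.

(** Covers the initial interval, where the bound [2/(K a)] of [Cin_sum_piece] blows up; the
    Lipschitz estimate bounds the integrand by 1. *)
Lemma Cin_sum_near_0 (K : nat) (h : R) : 0 <= h <= 1 -> Rabs (Cin_sum K h) <= h.
Proof.
intros Hh.
replace h with (h - 0) at 2 by ring.
replace (Cin_sum K h) with (Cin_sum K h - Cin_sum K 0) by (rewrite Cin_sum_0; ring).
apply (increment_abs_le (Cin_sum K) (fun y => y)
  (fun t => (square_wave_sum K 0 - square_wave_sum K t) / t) (fun _ => 1)).
- lra.
- intros; apply is_derive_Cin_sum; lra.
- intros; apply (is_derive_id (K := R_AbsRing)).
- intros; apply Cin_sum_continuous.
- intros; apply continuous_id.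
- intros t Ht; unfold Rdiv.
  rewrite Rabs_mult, Rabs_minus_sym, (Rabs_pos_eq (/ t)).
  2:{ left; apply Rinv_0_lt_compat; lra. }
  apply Rle_trans with (t * / t).
  + apply Rmult_le_compat_r; [left; apply Rinv_0_lt_compat; lra|].
    apply square_wave_sum_lipschitz; lra.
  + rewrite Rinv_r; lra.
Qed.

Lemma is_lim_seq_Cin_sum_half_PI : is_lim_seq (fun K => Cin_sum K (PI / 2)) 0.
Proof.
apply is_lim_seq_spec; intros eps.
assert (P2 := PI2_1). assert (Pe := cond_pos eps).
set (h := Rmin 1 (eps / 2)).
assert (Hh : 0 < h <= 1) by (unfold h; split; [apply Rmin_glb_lt; lra|apply Rmin_l]).
assert (He : h <= eps / 2) by apply Rmin_r.
(* For [j = 0] the factor [1 - (-1)^j] vanishes: before the first jump the square wave keeps its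
   value at 0. *)
assert (L := is_lim_seq_Cin_sum_piece 0 h (PI / 2) ltac:(lra)).
simpl INR in L; specialize (L ltac:(lra) ltac:(lra)).
apply is_lim_seq_spec in L.
destruct (L (mkposreal (eps / 2) ltac:(lra))) as [K0 HK0]; simpl in HK0.
exists K0; intros K HK; specialize (HK0 K HK).
assert (B := Cin_sum_near_0 K h ltac:(lra)).
apply Rabs_le_between in B; apply Rabs_lt_between in HK0; apply Rabs_lt_between; lra.
Qed.

Definition jump_node (j : nat) : R := INR (2 * j + 1) * (PI / 2).

Lemma jump_node_eq (j : nat) : jump_node j = INR j * PI + PI / 2.
Proof.
unfold jump_node; rewrite plus_INR, mult_INR; change (INR 2) with 2; change (INR 1) with 1.
field.
Qed.

(** The interval from node [N] to node [N + 1] is centred at [(N + 1) PI], so the piece with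
    [j = N + 1] applies and [1 - (-1)^j] becomes [1 + (-1)^N]. The common factor [PI/2] of the nodes
    cancels in the logarithms. *)
Lemma is_lim_seq_Cin_sum_node (N : nat) :
  is_lim_seq (fun K => Cin_sum K (jump_node N))
    (PI / 4 * bsum (fun j => (1 + (-1) ^ j)
        * (ln (INR (2 * j + 3)) - ln (INR (2 * j + 1)))) N).
Proof.
assert (P2 := PI2_1).
induction N as [|N IH].
- simpl bsum; rewrite Rmult_0_r; unfold jump_node.
  replace (INR (2 * 0 + 1) * (PI / 2)) with (PI / 2) by (simpl; ring).
  exact is_lim_seq_Cin_sum_half_PI.
- cbn [bsum]; rewrite Rmult_plus_distr_l.
  apply is_lim_seq_ext with (fun K => Cin_sum K (jump_node N)
     + (Cin_sum K (jump_node (S N)) - Cin_sum K (jump_node N))).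
  { intros K; ring. }
  apply is_lim_seq_plus'; [exact IH|].
  assert (N0 := pos_INR N).
  assert (L := is_lim_seq_Cin_sum_piece (S N) (jump_node N) (jump_node (S N))).
  rewrite !jump_node_eq in L |- *; rewrite S_INR in L |- *.
  specialize (L ltac:(nra) ltac:(nra) ltac:(nra)).
  replace (PI / 4 * ((1 + (-1) ^ N) * (ln (INR (2 * N + 3)) - ln (INR (2 * N + 1)))))
   with (PI / 4 * (1 - (-1) ^ S N) * (ln ((INR N + 1) * PI + PI / 2) - ln (INR N * PI + PI / 2)));
  [exact L|].
  rewrite !plus_INR, !mult_INR; change (INR 2) with 2; change (INR 1) with 1.
  replace (INR 3) with 3 by (simpl; ring).
  replace ((INR N + 1) * PI + PI / 2) with ((2 * INR N + 3) * (PI / 2)) by field.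
  replace (INR N * PI + PI / 2) with ((2 * INR N + 1) * (PI / 2)) by field.
  rewrite !ln_mult by lra; simpl pow; ring.
Qed.

(** Partial sums of [- beta'(1)], for Dirichlet's function [beta(s) = sum_k (-1)^k (2k+1)^(-s)]. *)
Definition beta_log_sum (K : nat) : R :=
  bsum (fun k => (-1) ^ k * (ln (INR (2 * k + 1)) / INR (2 * k + 1))) K.

Lemma sum_inv_odd_sqr (K : nat) :
  bsum (fun k => / INR (2 * k + 1) ^ 2) (S K) <= 2 - / INR (S K).
Proof.
induction K as [|K IH].
- simpl; lra.
- change (bsum (fun k => / INR (2 * k + 1) ^ 2) (S (S K))) with
    (bsum (fun k => / INR (2 * k + 1) ^ 2) (S K) + / INR (2 * S K + 1) ^ 2).
  assert (P := INR_S_pos K).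
  rewrite plus_INR, mult_INR, (S_INR (S K)); change (INR 2) with 2; change (INR 1) with 1.
  set (m := INR (S K)) in *.
  assert (/ (2 * m + 1) ^ 2 <= / (m * (m + 1))) by (apply Rinv_le_contravar; nra).
  replace (/ (m * (m + 1))) with (/ m - / (m + 1)) in H by (field; lra).
  lra.
Qed.

(** With [m = 2k+1], the error [2/(m X)] of the cosine integral is divided by another [m], and the
    sum of [1/m^2] stays below 2. The bound is therefore uniform in [K]. *)
Lemma beta_log_sum_Cin (K : nat) (X : R) : 0 < X ->
  Rabs (beta_log_sum K - (Cin_sum K X - (ln X + euler_gamma) * square_wave_sum K 0)) <= 4 / X.
Proof.
intros HX.
assert (H : Rabs (beta_log_sum K - (Cin_sum K X - (ln X + euler_gamma) * square_wave_sum K 0))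
   <= 2 / X * bsum (fun k => / INR (2 * k + 1) ^ 2) K).
{ induction K as [|K IH].
  - unfold beta_log_sum, Cin_sum, square_wave_sum; simpl.
    rewrite !Rmult_0_r, !Rminus_0_r, Rabs_R0; lra.
  - unfold beta_log_sum, Cin_sum, square_wave_sum in *; cbn [bsum].
    assert (Pm := INR_odd_pos K).
    assert (A := Cin_asymptotics (INR (2 * K + 1) * X) ltac:(nra)).
    rewrite ln_mult in A by lra; rewrite Rmult_0_r, cos_0.
    set (m := INR (2 * K + 1)) in *.
    assert (T : Rabs ((-1) ^ K * (ln m / m) - ((-1) ^ K * (Cin (m * X) / m)
       - (ln X + euler_gamma) * ((-1) ^ K * (1 / m)))) <= 2 / X * / m ^ 2).
    { replace ((-1) ^ K * (ln m / m) - ((-1) ^ K * (Cin (m * X) / m)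
       - (ln X + euler_gamma) * ((-1) ^ K * (1 / m)))) with
       ((-1) ^ K * (- (Cin (m * X) - (ln m + ln X) - euler_gamma) * / m)) by (field; lra).
      rewrite Rabs_mult, Rabs_pow_m1, Rmult_1_l, Rabs_mult, Rabs_Ropp.
      rewrite (Rabs_pos_eq (/ m)) by (left; apply Rinv_0_lt_compat; lra).
      replace (2 / X * / m ^ 2) with (2 / (m * X) * / m) by (field; lra).
      apply Rmult_le_compat_r; [left; apply Rinv_0_lt_compat; lra|exact A]. }
    apply Rabs_le_between in T, IH; apply Rabs_le; lra. }
eapply Rle_trans; [exact H|].
assert (IX := Rinv_0_lt_compat _ HX).
replace (4 / X) with (2 / X * 2) by (field; lra).
apply Rmult_le_compat_l; [unfold Rdiv; lra|].
destruct K as [|K]; [simpl; lra|].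
assert (Q := sum_inv_odd_sqr K). assert (P := Rinv_0_lt_compat _ (INR_S_pos K)); lra.
Qed.

(** Terms with odd [j] vanish; [j = 2i] contributes twice the logarithm of [(4i+3)/(4i+1)]. *)
Lemma jump_log_sum_even (M : nat) :
  bsum (fun j => (1 + (-1) ^ j) * (ln (INR (2 * j + 3)) - ln (INR (2 * j + 1)))) (2 * M)
  = 2 * bsum (fun i => ln (INR i + 3 / 4) - ln (INR i + 1 / 4)) M.
Proof.
induction M as [|M IH]; [simpl; ring|].
replace (2 * S M)%nat with (S (S (2 * M))) by lia.
cbn [bsum]; rewrite IH.
replace ((-1) ^ S (2 * M)) with (-1) by (rewrite pow_1_odd; reflexivity).
rewrite pow_1_even.
assert (P := pos_INR M).
replace (INR (2 * (2 * M) + 3)) with (4 * (INR M + 3 / 4)).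
2:{ rewrite plus_INR, !mult_INR; simpl; field. }
replace (INR (2 * (2 * M) + 1)) with (4 * (INR M + 1 / 4)).
2:{ rewrite plus_INR, !mult_INR; simpl; field. }
rewrite !ln_mult by lra; ring.
Qed.

Lemma is_lim_seq_beta_log_sum (l : R) :
  is_lim_seq (fun M => 2 * bsum (fun i => ln (INR i + 3 / 4) - ln (INR i + 1 / 4)) M
     - ln (2 * PI * (INR M + 1 / 4))) l ->
  is_lim_seq beta_log_sum (PI / 4 * (l - euler_gamma)).
Proof.
intros Hl.
assert (P2 := PI2_1).
assert (HX : is_lim_seq (fun M => 4 / jump_node (2 * M)) 0).
{ apply is_lim_seq_le_le_loc with (fun _ => 0) (fun M => 1 / INR M).
  - exists 1%nat; intros M HM; rewrite jump_node_eq, mult_INR; change (INR 2) with 2.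
    assert (PM : 0 < INR M) by (apply lt_0_INR; lia).
    split; [apply Rdiv_le_0_compat; nra|].
    apply Rmult_le_reg_r with (INR M * (2 * INR M * PI + PI / 2)); [nra|].
    replace (4 / (2 * INR M * PI + PI / 2) * (INR M * (2 * INR M * PI + PI / 2)))
      with (4 * INR M) by (field; nra).
    replace (1 / INR M * (INR M * (2 * INR M * PI + PI / 2)))
      with (2 * INR M * PI + PI / 2) by (field; lra).
    nra.
  - apply is_lim_seq_const.
  - apply is_lim_seq_div_INR. }
apply is_lim_seq_spec in Hl, HX; apply is_lim_seq_spec; intros eps.
assert (Pe := cond_pos eps).
destruct (Hl (mkposreal (eps / 4) ltac:(lra))) as [M1 H1]; simpl in H1.
destruct (HX (mkposreal (eps / 4) ltac:(lra))) as [M2 H2]; cbn [pos] in H2.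
(* [X] is fixed here, depending on [eps] alone; [K] is chosen afterwards. Three errors of at most
   [eps/4] result: the asymptotics of the logarithmic sum, the replacement of logarithms by [Cin],
   and the limit in [K]. *)
set (M := (M1 + M2)%nat).
specialize (H1 M ltac:(lia)); specialize (H2 M ltac:(lia)).
set (X := jump_node (2 * M)) in *.
assert (M0 := pos_INR M).
assert (EX : X = 2 * PI * (INR M + 1 / 4)).
{ unfold X; rewrite jump_node_eq, mult_INR; change (INR 2) with 2; field. }
assert (X0 : 0 < X) by (rewrite EX; nra).
rewrite <- EX in H1.
set (U := bsum (fun i => ln (INR i + 3 / 4) - ln (INR i + 1 / 4)) M) in *.
assert (L : is_lim_seq (fun K => Cin_sum K X - (ln X + euler_gamma) * square_wave_sum K 0)
   (PI / 4 * (2 * U) - (ln X + euler_gamma) * (PI / 4))).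
{ apply is_lim_seq_minus'.
  - unfold U; rewrite <- jump_log_sum_even; apply is_lim_seq_Cin_sum_node.
  - apply (is_lim_seq_scal_l _ (ln X + euler_gamma) (PI / 4)), is_lim_seq_leibniz. }
apply is_lim_seq_spec in L.
destruct (L (mkposreal (eps / 4) ltac:(lra))) as [K0 H3]; simpl in H3.
exists K0; intros K HK; specialize (H3 K HK).
assert (H4 := beta_log_sum_Cin K X X0).
assert (P4 : PI / 4 <= 1) by (assert (H := PI_4); lra).
set (v := 2 * U - ln X - l) in *.
replace (PI / 4 * (2 * U) - (ln X + euler_gamma) * (PI / 4))
  with (PI / 4 * (l - euler_gamma) + PI / 4 * v) in H3 by (unfold v; field).
apply Rabs_lt_between in H1, H2, H3; apply Rabs_le_between in H4; apply Rabs_lt_between.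
assert (- (eps / 4) <= PI / 4 * v <= eps / 4) by nra.
lra.
Qed.

(** * Gauss's product for the Gamma function *)

(** Logarithm of the Pochhammer symbol [x (x+1) ... (x+n-1)] for [x > 0]; at [x = 1] this is
    [ln n!]. *)
Definition lpoch (x : R) (n : nat) : R := bsum (fun i => ln (x + INR i)) n.

Definition gamma_kernel (x t : R) : R := Rpower t (x - 1) * exp (- t).

(** A relation rather than the total function [Gamma], so that convergence of the integral is part
    of the statement. *)
Definition is_Gamma (x v : R) : Prop :=
  is_RInt_gen (gamma_kernel x) (at_right 0) (Rbar_locally p_infty) v.

(** * Convergence and functional equation of Euler's integral *)

Lemma filter_prod_pos (P : R * R -> Prop) :
  (forall a b, 0 < a < 1 -> 1 < b -> P (a, b)) ->
  filter_prod (at_right 0) (Rbar_locally p_infty) P.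
Proof.
intros H; apply Filter_prod with (fun a => 0 < a < 1) (fun b => 1 < b).
- exists (mkposreal 1 Rlt_0_1); intros y Hy Hy0.
  change (Rabs (y - 0) < 1) in Hy; apply Rabs_lt_between in Hy; lra.
- exists 1; auto.
- auto.
Qed.

(** The value is the supremum of the proper integrals; nonnegativity makes them grow with the
    interval, so those containing a nearly optimal [[a0, b0]] are also close to the supremum. *)
Lemma is_RInt_gen_nonneg_ex (f : R -> R) (B : R) :
  (forall t, 0 < t -> continuous f t) -> (forall t, 0 < t -> 0 <= f t) ->
  (forall a b, 0 < a <= b -> RInt f a b <= B) ->
  exists v, is_RInt_gen f (at_right 0) (Rbar_locally p_infty) v.
Proof.
intros Cf Pf HB.
assert (X : forall a b, 0 < a -> 0 < b -> ex_RInt f a b).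
{ intros a b Ha Hb; apply (ex_RInt_continuous f); intros z Hz; apply Cf.
  assert (0 < Rmin a b) by (apply Rmin_glb_lt; lra); lra. }
set (E := fun y => exists a b, 0 < a <= b /\ y = RInt f a b).
destruct (completeness E) as [v [Hub Hlub]].
- exists B; intros y (a & b & H & ->); auto.
- exists (RInt f 1 1), 1, 1; split; [lra|reflexivity].
- exists v; intros P [eps HP].
  assert (Hx : exists a b, 0 < a <= b /\ v - eps < RInt f a b).
  { apply NNPP; intros N.
    assert (v <= v - eps); [|assert (Q := cond_pos eps); lra].
    apply Hlub; intros y (a & b & H & ->).
    destruct (Rle_dec (RInt f a b) (v - eps)); [assumption|].
    exfalso; apply N; exists a, b; split; [exact H|lra]. }
  destruct Hx as (a0 & b0 & H0 & Hv).
  unfold filtermapi.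
  apply Filter_prod with (fun a => 0 < a < a0) (fun b => b0 < b).
  + exists (mkposreal a0 (proj1 H0)); intros y Hy Hy0.
    change (Rabs (y - 0) < a0) in Hy; apply Rabs_lt_between in Hy; lra.
  + exists b0; auto.
  + intros a b Ha Hb; exists (RInt f a b); split.
    * apply (RInt_correct f), X; lra.
    * apply HP; change (Rabs (RInt f a b - v) < eps).
      assert (U : RInt f a b <= v) by (apply Hub; exists a, b; split; [lra|reflexivity]).
      assert (C1 := RInt_Chasles f a a0 b (X a a0 ltac:(lra) ltac:(lra)) (X a0 b ltac:(lra) ltac:(lra))).
      assert (C2 := RInt_Chasles f a0 b0 b (X a0 b0 ltac:(lra) ltac:(lra)) (X b0 b ltac:(lra) ltac:(lra))).
      assert (I1 := RInt_ge_0 f a a0 ltac:(lra) (X a a0 ltac:(lra) ltac:(lra))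
         ltac:(intros; apply Pf; lra)).
      assert (I2 := RInt_ge_0 f b0 b ltac:(lra) (X b0 b ltac:(lra) ltac:(lra))
         ltac:(intros; apply Pf; lra)).
      unfold plus in C1, C2; simpl in C1, C2.
      apply Rabs_lt_between; lra.
Qed.

Lemma is_derive_power_exp (x t : R) : 0 < t ->
  is_derive (fun t => Rpower t x * exp (- t)) t (x * gamma_kernel x t - gamma_kernel (x + 1) t).
Proof.
intros Ht; unfold gamma_kernel, Rpower.
replace (x * (exp ((x - 1) * ln t) * exp (- t)) - exp ((x + 1 - 1) * ln t) * exp (- t))
 with (x * / t * exp (x * ln t) * exp (- t) - exp (x * ln t) * exp (- t)).
- auto_derive; [lra|field; lra].
- replace ((x - 1) * ln t) with (x * ln t + - ln t) by ring.
  replace ((x + 1 - 1) * ln t) with (x * ln t) by ring.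
  rewrite exp_plus, (exp_Ropp (ln t)), exp_ln by lra; ring.
Qed.

Lemma gamma_kernel_continuous (x t : R) : 0 < t -> continuous (gamma_kernel x) t.
Proof.
intros Ht; apply (ex_derive_continuous (gamma_kernel x)).
unfold gamma_kernel; eexists; apply is_derive_power_exp, Ht.
Qed.

Lemma gamma_kernel_pos (x t : R) : 0 < gamma_kernel x t.
Proof. apply Rmult_lt_0_compat; apply exp_pos. Qed.

Lemma is_Gamma_ex (x : R) : 0 < x <= 1 -> exists v, is_Gamma x v.
Proof.
intros Hx.
apply is_RInt_gen_nonneg_ex with (4 / x).
- intros; now apply gamma_kernel_continuous.
- intros; left; apply gamma_kernel_pos.
- intros a b Hab.
  (* This is [(4/x) (t/(1+t))^x], bounded by [4/x], with derivative [4 t^(x-1) / (1+t)^(x+1)]. It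
     dominates the kernel at both ends at once, since [(1+t)^(x+1) <= (1+t)^2 <= 4 exp t] for
     [x <= 1]. *)
  set (G := fun t => 4 / x * exp (x * (ln t - ln (1 + t)))).
  assert (DG : forall t, 0 < t -> is_derive G t
     (4 * (/ t - / (1 + t)) * exp (x * (ln t - ln (1 + t))))).
  { intros t Ht; unfold G; auto_derive; [lra|].
    rewrite (Rminus_def (ln t)); field; lra. }
  assert (DF : forall t, a <= t <= b -> is_derive (RInt (gamma_kernel x) a) t (gamma_kernel x t)).
  { intros t Ht; apply (is_derive_RInt (gamma_kernel x) _ a t).
    - exists (mkposreal t ltac:(lra)); intros y Hy.
      change (Rabs (y - t) < t) in Hy; apply Rabs_lt_between in Hy.
      apply (RInt_correct (gamma_kernel x)), (ex_RInt_continuous (gamma_kernel x)).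
      intros z Hz; apply gamma_kernel_continuous.
      assert (0 < Rmin a y) by (apply Rmin_glb_lt; lra); lra.
    - apply gamma_kernel_continuous; lra. }
  assert (H : RInt (gamma_kernel x) a b - RInt (gamma_kernel x) a a <= G b - G a).
  { apply increment_le with (gamma_kernel x)
      (fun t => 4 * (/ t - / (1 + t)) * exp (x * (ln t - ln (1 + t)))).
    - lra.
    - intros; apply DF; lra.
    - intros; apply DG; lra.
    - intros t Ht; eapply continuous_of_derive, DF, Ht.
    - intros t Ht; eapply continuous_of_derive, DG; lra.
    - intros t Ht; unfold gamma_kernel, Rpower.
      replace ((x - 1) * ln t) with (x * ln t + - ln t) by ring.
      replace (x * (ln t - ln (1 + t))) with (x * ln t + - (x * ln (1 + t))) by ring.
      rewrite !exp_plus, !exp_Ropp, exp_ln by lra.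
      assert (P := exp_pos (x * ln t)). assert (Q := exp_pos (x * ln (1 + t))).
      assert (L : 0 <= ln (1 + t)) by (rewrite <- ln_1; apply ln_le; lra).
      assert (Q1 : exp (x * ln (1 + t)) <= 1 + t).
      { rewrite <- (exp_ln (1 + t)) at 2 by lra.
        destruct (Rle_lt_or_eq_dec (x * ln (1 + t)) (ln (1 + t))) as [h|h]; [nra| |].
        - left; now apply exp_increasing.
        - rewrite h; apply Rle_refl. }
      assert (Et : (1 + t) ^ 2 <= 4 * exp t).
      { replace t with (t / 2 + t / 2) at 2 by field; rewrite exp_plus.
        assert (S := exp_ineq1_le (t / 2)); nra. }
      assert (Pt := exp_pos t).
      set (u := exp (x * ln t)) in *; set (z := exp (x * ln (1 + t))) in *.
      apply Rmult_le_reg_r with (t * (1 + t) * z * exp t).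
      { repeat apply Rmult_lt_0_compat; lra. }
      replace (u * / t * / exp t * (t * (1 + t) * z * exp t)) with (u * ((1 + t) * z)) by (field; lra).
      replace (4 * (/ t - / (1 + t)) * (u * / z) * (t * (1 + t) * z * exp t)) with (u * (4 * exp t))
        by (field; lra).
      apply Rmult_le_compat_l; nra. }
  rewrite RInt_point in H; unfold zero in H; simpl in H.
  assert (Ga : 0 < G a).
  { apply Rmult_lt_0_compat; [apply Rdiv_lt_0_compat; lra|apply exp_pos]. }
  assert (Gb : G b <= 4 / x).
  { rewrite <- (Rmult_1_r (4 / x)); apply Rmult_le_compat_l.
    - apply Rdiv_le_0_compat; lra.
    - apply Rle_trans with (exp 0); [|rewrite exp_0; apply Rle_refl].
      left; apply exp_increasing.
      assert (ln b < ln (1 + b)) by (clear H; apply ln_increasing; lra); nra. }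
  lra.
Qed.

Lemma power_exp_lim_0 (x : R) : 0 < x ->
  filterlim (fun t => Rpower t x * exp (- t)) (at_right 0) (locally 0).
Proof.
intros Hx; apply filterlim_locally; intros eps.
exists (mkposreal (exp (ln eps / x)) (exp_pos _)); intros y Hy Hy0.
change (Rabs (y - 0) < exp (ln eps / x)) in Hy.
change (Rabs (Rpower y x * exp (- y) - 0) < eps).
rewrite Rminus_0_r in Hy |- *; rewrite Rabs_pos_eq in Hy by lra.
rewrite Rabs_pos_eq by (left; apply Rmult_lt_0_compat; apply exp_pos).
assert (Pe := cond_pos eps).
assert (L : ln y < ln eps / x) by (rewrite <- (ln_exp (ln eps / x)); apply ln_increasing; lra).
apply Rle_lt_trans with (Rpower y x * 1).
- apply Rmult_le_compat_l; [left; apply exp_pos|].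
  rewrite <- exp_0; left; apply exp_increasing; lra.
- rewrite Rmult_1_r, <- (exp_ln eps) by lra; apply exp_increasing.
  apply Rmult_lt_compat_l with (r := x) in L; [|lra].
  replace (x * (ln eps / x)) with (ln eps) in L by (field; lra); exact L.
Qed.

Lemma power_exp_lim_p_infty (x : R) : 0 < x ->
  filterlim (fun t => Rpower t x * exp (- t)) (Rbar_locally p_infty) (locally 0).
Proof.
intros Hx.
assert (L := is_lim_div_ln_p). apply is_lim_spec in L.
(* The bound [ln y / y < 1/(2x)] gives [x ln y <= y/2], so half of the exponential decay survives;
   it is below [eps] once [y > -2 ln eps]. *)
destruct (L (mkposreal (/ (2 * x)) ltac:(apply Rinv_0_lt_compat; lra))) as [M HM].
simpl in HM.
apply filterlim_locally; intros eps.
exists (Rmax (Rmax M 0) (- 2 * ln eps)); intros y Hy.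
assert (H1 := Rmax_l (Rmax M 0) (- 2 * ln eps)). assert (H2 := Rmax_r (Rmax M 0) (- 2 * ln eps)).
assert (H3 := Rmax_l M 0). assert (H4 := Rmax_r M 0).
change (Rabs (Rpower y x * exp (- y) - 0) < eps).
rewrite Rminus_0_r, Rabs_pos_eq by (left; apply Rmult_lt_0_compat; apply exp_pos).
assert (Pe := cond_pos eps).
specialize (HM y ltac:(lra)); rewrite Rminus_0_r in HM; apply Rabs_lt_between in HM.
unfold Rpower; rewrite <- exp_plus, <- (exp_ln eps) by lra; apply exp_increasing.
assert (x * ln y <= y / 2).
{ apply Rle_trans with (x * y * (ln y / y)); [right; field; lra|].
  apply Rle_trans with (x * y * / (2 * x)); [|right; field; lra].
  apply Rmult_le_compat_l; [nra|lra]. }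
lra.
Qed.

(** Integration by parts: [t^x exp(-t)] vanishes at both ends and its derivative is the difference
    of the two integrands. *)
Lemma is_Gamma_succ (x v : R) : 0 < x -> is_Gamma x v -> is_Gamma (x + 1) (x * v).
Proof.
intros Hx Hv.
set (h := fun t => Rpower t x * exp (- t)).
assert (D : forall t, 0 < t -> Derive h t = x * gamma_kernel x t - gamma_kernel (x + 1) t).
{ intros t Ht; apply is_derive_unique, is_derive_power_exp, Ht. }
assert (H : is_RInt_gen (Derive h) (at_right 0) (Rbar_locally p_infty) (0 - 0)).
{ apply is_RInt_gen_Derive.
  - apply filter_prod_pos; intros a b Ha Hb t; simpl; rewrite Rmin_left by lra; intros Ht.
    eexists; apply is_derive_power_exp; lra.
  - apply filter_prod_pos; intros a b Ha Hb t; simpl; rewrite Rmin_left by lra; intros Ht.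
    apply continuous_ext_loc with (fun t => x * gamma_kernel x t - gamma_kernel (x + 1) t).
    + exists (mkposreal t ltac:(lra)); intros y Hy.
      change (Rabs (y - t) < t) in Hy; apply Rabs_lt_between in Hy.
      symmetry; apply D; lra.
    + apply (continuous_minus (fun t => x * gamma_kernel x t) (gamma_kernel (x + 1))).
      * apply (continuous_scal_r x (gamma_kernel x)), gamma_kernel_continuous; lra.
      * apply gamma_kernel_continuous; lra.
  - now apply power_exp_lim_0.
  - now apply power_exp_lim_p_infty. }
assert (K := is_RInt_gen_minus _ _ _ _ (is_RInt_gen_scal _ x _ Hv) H).
unfold is_Gamma.
replace (x * v) with (minus (scal x v) (0 - 0)).
2:{ unfold minus, plus, opp, scal; simpl; unfold mult; simpl; ring. }
apply is_RInt_gen_ext with (2 := K).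
apply filter_prod_pos; intros a b Ha Hb t; simpl; rewrite Rmin_left by lra; intros Ht.
rewrite D by lra.
unfold minus, plus, opp, scal; simpl; unfold mult; simpl; ring.
Qed.

Lemma is_Gamma_1 : is_Gamma 1 1.
Proof.
assert (D : forall t, is_derive (fun t => - exp (- t)) t (exp (- t))).
{ intros t; auto_derive; [trivial|ring]. }
unfold is_Gamma.
replace 1 with (0 - - exp (- 0)) at 2 by (rewrite Ropp_0, exp_0; ring).
apply is_RInt_gen_ext with (Derive (fun t => - exp (- t))).
{ apply filter_prod_pos; intros a b Ha Hb t; simpl; rewrite Rmin_left by lra; intros Ht.
  transitivity (exp (- t)); [apply is_derive_unique, D|].
  unfold gamma_kernel; rewrite Rminus_diag, Rpower_O by lra; ring. }
apply is_RInt_gen_Derive.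
- apply filter_prod_pos; intros a b Ha Hb t _; eexists; apply D.
- apply filter_prod_pos; intros a b Ha Hb t _.
  apply continuous_ext with (fun t => exp (- t)).
  { intros y; symmetry; apply is_derive_unique, D. }
  apply (ex_derive_continuous (fun t => exp (- t))); auto_derive; trivial.
- eapply filterlim_filter_le_1, (continuous_of_derive _ 0 _ (D 0)).
  apply filter_le_within.
- apply filterlim_locally; intros eps; exists (- ln eps); intros y Hy.
  change (Rabs (- exp (- y) - 0) < eps).
  rewrite Rminus_0_r, Rabs_Ropp, Rabs_pos_eq by (left; apply exp_pos).
  rewrite <- (exp_ln eps) by apply cond_pos; apply exp_increasing; lra.
Qed.

(** Concavity of [t^p]: the right-hand side is the tangent at [c]. Writing [t = c exp y] reduces it
    to [exp(p y) <= (1-p) + p exp y], the combination of [F1] and [F2] with weights [1-p] and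
    [p]. *)
Lemma power_le_tangent (c t p : R) : 0 < c -> 0 < t -> 0 <= p <= 1 ->
  Rpower t p <= (1 - p) * Rpower c p + p * Rpower c (p - 1) * t.
Proof.
intros Hc Ht Hp; unfold Rpower.
set (y := ln t - ln c).
replace (p * ln t) with (p * ln c + p * y) by (unfold y; ring).
replace (p * exp ((p - 1) * ln c) * t) with (p * (exp (p * ln c) * exp y)).
2:{ rewrite <- (exp_ln t) at 1 by exact Ht.
    rewrite !Rmult_assoc, <- !exp_plus; unfold y; do 2 f_equal; ring. }
rewrite exp_plus.
assert (P := exp_pos (p * ln c)).
assert (E1 : 1 - p * y <= exp (- (p * y))) by (assert (H := exp_ineq1_le (- (p * y))); lra).
assert (E2 : 1 + (1 - p) * y <= exp ((1 - p) * y)) by apply exp_ineq1_le.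
assert (Q := exp_pos (p * y)).
assert (F1 : exp (p * y) * (1 - p * y) <= 1).
{ apply Rle_trans with (exp (p * y) * exp (- (p * y))).
  - apply Rmult_le_compat_l; lra.
  - rewrite <- exp_plus, Rplus_opp_r, exp_0; apply Rle_refl. }
assert (F2 : exp (p * y) * (1 + (1 - p) * y) <= exp y).
{ apply Rle_trans with (exp (p * y) * exp ((1 - p) * y)).
  - apply Rmult_le_compat_l; lra.
  - rewrite <- exp_plus; right; f_equal; ring. }
set (u := exp (p * y)) in *.
assert (u <= (1 - p) + p * exp y) by nra.
nra.
Qed.

(** The tangent inequality at [c = y] is integrated against the kernel of [Gamma(y)]. Since [y] is
    the mean of [t] for that weight, the two terms add up to exactly [y^p v]. *)
Lemma is_Gamma_power_bound (y p v w : R) : 0 < y -> 0 <= p <= 1 ->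
  is_Gamma y v -> is_Gamma (y + p) w -> w <= Rpower y p * v.
Proof.
intros Hy Hp Hv Hw.
assert (Hv1 := is_Gamma_succ y v Hy Hv).
assert (K := is_RInt_gen_plus _ _ _ _ (is_RInt_gen_scal _ ((1 - p) * Rpower y p) _ Hv)
   (is_RInt_gen_scal _ (p * Rpower y (p - 1)) _ Hv1)).
replace (Rpower y p * v) with (plus (scal ((1 - p) * Rpower y p) v)
   (scal (p * Rpower y (p - 1)) (y * v))).
2:{ unfold plus, scal; simpl; unfold mult; simpl.
    replace (Rpower y p) with (Rpower y (p - 1) * y); [ring|].
    rewrite <- (Rpower_1 y) at 2 by exact Hy; rewrite <- Rpower_plus; f_equal; ring. }
apply Rle_trans with (1 := Rle_abs w).
apply (RInt_gen_norm (gamma_kernel (y + p)) _ w _) with (3 := Hw) (4 := K).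
- apply filter_prod_pos; intros a b Ha Hb; simpl; lra.
- apply filter_prod_pos; intros a b Ha Hb t; simpl; intros Ht.
  change (norm (gamma_kernel (y + p) t)) with (Rabs (gamma_kernel (y + p) t)).
  rewrite Rabs_pos_eq by (left; apply gamma_kernel_pos).
  unfold plus, scal; simpl; unfold mult; simpl; unfold gamma_kernel.
  replace (y + p - 1) with ((y - 1) + p) by ring.
  replace (y + 1 - 1) with ((y - 1) + 1) by ring.
  rewrite !Rpower_plus, Rpower_1 by lra.
  assert (C := power_le_tangent y t p Hy ltac:(lra) Hp).
  assert (P := exp_pos (- t)). assert (Q := exp_pos ((y - 1) * ln t)). fold (Rpower t (y - 1)) in Q.
  set (A := Rpower t (y - 1)) in *.
  assert (0 < A * exp (- t)) by now apply Rmult_lt_0_compat.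
  assert (Rpower t p * (A * exp (- t)) <=
    ((1 - p) * Rpower y p + p * Rpower y (p - 1) * t) * (A * exp (- t)))
    by (apply Rmult_le_compat_r; lra).
  lra.
Qed.

Lemma is_Gamma_lpoch (x v : R) (n : nat) : 0 < x -> is_Gamma x v ->
  is_Gamma (x + INR n) (v * exp (lpoch x n)).
Proof.
intros Hx Hv; induction n as [|n IH].
- unfold lpoch; simpl; rewrite exp_0, Rplus_0_r, Rmult_1_r; exact Hv.
- assert (P := pos_INR n).
  rewrite S_INR; unfold lpoch in *; cbn [bsum].
  rewrite exp_plus, exp_ln by lra.
  replace (x + (INR n + 1)) with (x + INR n + 1) by ring.
  replace (v * (exp (bsum (fun i => ln (x + INR i)) n) * (x + INR n)))
    with ((x + INR n) * (v * exp (bsum (fun i => ln (x + INR i)) n))) by ring.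
  apply is_Gamma_succ; [lra|exact IH].
Qed.

(** From [1 = Gamma(1) <= x^(1-x) Gamma(x)]. *)
Lemma is_Gamma_pos (x v : R) : 0 < x <= 1 -> is_Gamma x v -> 0 < v.
Proof.
intros Hx Hv.
assert (H := is_Gamma_power_bound x (1 - x) v 1 ltac:(lra) ltac:(lra) Hv).
replace (x + (1 - x)) with 1 in H by ring; specialize (H is_Gamma_1).
assert (P := exp_pos ((1 - x) * ln x)); fold (Rpower x (1 - x)) in P; nra.
Qed.

Lemma ln_exp_mult (v s : R) : 0 < v -> ln (v * exp s) = ln v + s.
Proof. intros Hv; rewrite ln_mult, ln_exp by (try apply exp_pos; lra); reflexivity. Qed.

(* Log-convexity bounds both [Gamma (x + n)] by [n^x Gamma n] and [Gamma (n + 1)] by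
   [(x + n)^(1-x) Gamma (x + n)]. *)
Lemma gauss_product_bounds (x v : R) (n : nat) : 0 < x <= 1 -> is_Gamma x v -> (0 < n)%nat ->
  - / INR n <= ln v + lpoch x n - lpoch 1 n + (1 - x) * ln (INR n) <= 0.
Proof.
intros Hx Hv Hn.
assert (v0 := is_Gamma_pos x v Hx Hv).
assert (Pn : 1 <= INR n) by (apply (le_INR 1); lia).
assert (Gx := is_Gamma_lpoch x v n ltac:(lra) Hv).
split.
- assert (G1 := is_Gamma_lpoch 1 1 n ltac:(lra) is_Gamma_1).
  replace (1 + INR n) with (x + INR n + (1 - x)) in G1 by ring.
  assert (B := is_Gamma_power_bound (x + INR n) (1 - x) _ _ ltac:(lra) ltac:(lra) Gx G1).
  apply ln_le in B; [|rewrite Rmult_1_l; apply exp_pos].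
  rewrite Rmult_1_l, ln_exp in B.
  unfold Rpower in B; rewrite Rmult_comm, ln_exp_mult, ln_exp_mult in B; [|lra|].
  2:{ apply Rmult_lt_0_compat; [lra|apply exp_pos]. }
  (* Replacing [(x+n)^(1-x)] by [n^(1-x)] costs at most [(1-x) x / n <= 1/n] in the logarithm. *)
  assert (C := ln_le_sub1 ((x + INR n) / INR n) ltac:(apply Rdiv_lt_0_compat; lra)).
  rewrite ln_div in C by lra.
  replace ((x + INR n) / INR n - 1) with (x * / INR n) in C by (field; lra).
  assert (I := Rinv_0_lt_compat (INR n) ltac:(lra)).
  assert ((1 - x) * (ln (x + INR n) - ln (INR n)) <= 1 * / INR n).
  { apply Rle_trans with ((1 - x) * (x * / INR n)); [apply Rmult_le_compat_l; lra|].
    rewrite <- Rmult_assoc; apply Rmult_le_compat_r; nra. }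
  lra.
- destruct n as [|m]; [lia|].
  assert (G1 := is_Gamma_lpoch 1 1 m ltac:(lra) is_Gamma_1).
  rewrite S_INR, (Rplus_comm (INR m) 1) in Gx, Pn |- *.
  rewrite (Rplus_comm x) in Gx.
  assert (B := is_Gamma_power_bound (1 + INR m) x _ _ ltac:(lra) ltac:(lra) G1 Gx).
  apply ln_le in B; [|apply Rmult_lt_0_compat; [lra|apply exp_pos]].
  unfold Rpower in B; rewrite Rmult_1_l, ln_exp_mult, <- exp_plus, ln_exp in B by lra.
  assert (E : lpoch 1 (S m) = lpoch 1 m + ln (1 + INR m)) by reflexivity.
  rewrite E; lra.
Qed.

Lemma is_lim_seq_gauss_product (x v : R) : 0 < x <= 1 -> is_Gamma x v ->
  is_lim_seq (fun n => lpoch x n - lpoch 1 n + (1 - x) * ln (INR n)) (- ln v).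
Proof.
intros Hx Hv.
apply is_lim_seq_ext with
  (fun n => (ln v + lpoch x n - lpoch 1 n + (1 - x) * ln (INR n)) - ln v).
{ intros n; ring. }
replace (Finite (- ln v)) with (Finite (0 - ln v)) by (f_equal; ring).
apply is_lim_seq_minus'; [|apply is_lim_seq_const].
apply is_lim_seq_le_le_loc with (fun n => -1 * / INR n) (fun _ => 0).
- exists 1%nat; intros n Hn; assert (B := gauss_product_bounds x v n Hx Hv Hn); lra.
- replace (Finite 0) with (Rbar_mult (-1) 0) by (simpl; f_equal; ring).
  apply (is_lim_seq_scal_l (fun n => / INR n)), is_lim_seq_inv_INR.
- apply is_lim_seq_const.
Qed.

(** * Wallis's product *)

Definition wallis_integral (n : nat) : R := RInt (fun t => sin t ^ n) 0 (PI / 2).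

Lemma ex_RInt_sin_pow (n : nat) (a b : R) : ex_RInt (fun t => sin t ^ n) a b.
Proof.
apply (ex_RInt_continuous (fun t => sin t ^ n)); intros z _.
apply (ex_derive_continuous (fun t => sin t ^ n)); auto_derive; trivial.
Qed.

(** The function [- cos t sin(t)^(n+1)] vanishes at 0 and at [PI/2], and its derivative is
    [(n+2) sin^(n+2) - (n+1) sin^n]. *)
Lemma wallis_integral_rec (n : nat) :
  INR (n + 2) * wallis_integral (n + 2) = INR (n + 1) * wallis_integral n.
Proof.
assert (H : is_RInt (fun t => INR (n + 2) * sin t ^ (n + 2) - INR (n + 1) * sin t ^ n) 0 (PI / 2)
  (minus (- cos (PI / 2) * sin (PI / 2) ^ (n + 1)) (- cos 0 * sin 0 ^ (n + 1)))).
{ apply (is_RInt_derive (fun t => - cos t * sin t ^ (n + 1))).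
  - intros t _.
    replace (INR (n + 2) * sin t ^ (n + 2) - INR (n + 1) * sin t ^ n)
      with (sin t * sin t ^ (n + 1) + - cos t * (INR (n + 1) * cos t * sin t ^ n)).
    + auto_derive; [trivial|].
      replace (n + 1)%nat with (S n) by lia; simpl pred; ring.
    + assert (Q := sin2_cos2 t); unfold Rsqr in Q.
      rewrite !pow_add, !plus_INR; simpl INR.
      replace (- cos t * ((INR n + 1) * cos t * sin t ^ n))
        with (- (INR n + 1) * (cos t * cos t) * sin t ^ n) by ring.
      replace (cos t * cos t) with (1 - sin t * sin t) by lra; ring.
  - intros t _.
    apply (ex_derive_continuous
      (fun t => INR (n + 2) * sin t ^ (n + 2) - INR (n + 1) * sin t ^ n)).
    auto_derive; trivial. }
assert (K := is_RInt_minus _ _ _ _ _ _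
  (is_RInt_scal _ _ _ (INR (n + 2)) _ (RInt_correct _ _ _ (ex_RInt_sin_pow (n + 2) 0 (PI / 2))))
  (is_RInt_scal _ _ _ (INR (n + 1)) _ (RInt_correct _ _ _ (ex_RInt_sin_pow n 0 (PI / 2))))).
apply (is_RInt_unique (V := R_CompleteNormedModule)) in H.
change (is_RInt (fun t => INR (n + 2) * sin t ^ (n + 2) - INR (n + 1) * sin t ^ n) 0 (PI / 2)
  (INR (n + 2) * wallis_integral (n + 2) - INR (n + 1) * wallis_integral n)) in K.
apply (is_RInt_unique (V := R_CompleteNormedModule)) in K; rewrite H in K.
rewrite cos_PI2, sin_0, (pow_ne_zero (n + 1)) in K by lia.
unfold minus, plus, opp in K; simpl in K; lra.
Qed.

Lemma wallis_integral_decr (n : nat) : wallis_integral (S n) <= wallis_integral n.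
Proof.
assert (P2 := PI2_1).
apply RInt_le; [lra|apply ex_RInt_sin_pow|apply ex_RInt_sin_pow|].
intros t Ht.
assert (S0 : 0 < sin t) by (apply sin_gt_0; lra).
assert (P := pow_lt _ n S0). destruct (SIN_bound t); simpl; nra.
Qed.

(** Logarithm of the central binomial coefficient [binom(2n, n)] divided by [4^n]. *)
Definition log_wallis_ratio (n : nat) : R := lpoch (1 / 2) n - lpoch 1 n.

Lemma log_wallis_ratio_succ (n : nat) :
  exp (log_wallis_ratio (S n)) = exp (log_wallis_ratio n) * ((1 / 2 + INR n) / (1 + INR n)).
Proof.
assert (P := pos_INR n).
unfold log_wallis_ratio, lpoch; cbn [bsum].
replace (bsum (fun i => ln (1 / 2 + INR i)) n + ln (1 / 2 + INR n) -
 (bsum (fun i => ln (1 + INR i)) n + ln (1 + INR n))) with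
 (bsum (fun i => ln (1 / 2 + INR i)) n - bsum (fun i => ln (1 + INR i)) n
  + (ln (1 / 2 + INR n) - ln (1 + INR n))) by ring.
rewrite exp_plus, <- ln_div, exp_ln by (try apply Rdiv_lt_0_compat; lra); reflexivity.
Qed.

Lemma log_wallis_ratio_0 : log_wallis_ratio 0 = 0.
Proof. unfold log_wallis_ratio, lpoch; simpl; ring. Qed.

Lemma wallis_integral_even (n : nat) :
  wallis_integral (2 * n) = exp (log_wallis_ratio n) * (PI / 2).
Proof.
induction n as [|n IH].
- rewrite log_wallis_ratio_0, exp_0; unfold wallis_integral; simpl.
  rewrite RInt_const; unfold scal; simpl; unfold mult; simpl; ring.
- assert (P := pos_INR n).
  assert (R := wallis_integral_rec (2 * n)).
  rewrite IH, !plus_INR, mult_INR in R.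
  change (INR 2) with 2 in R; change (INR 1) with 1 in R.
  replace (2 * S n)%nat with (2 * n + 2)%nat by lia.
  rewrite log_wallis_ratio_succ.
  apply Rmult_eq_reg_l with (2 * INR n + 2); [|lra].
  rewrite R; field; lra.
Qed.

Lemma wallis_integral_odd (n : nat) :
  wallis_integral (2 * n + 1) = / (exp (log_wallis_ratio n) * (2 * INR n + 1)).
Proof.
induction n as [|n IH].
- rewrite log_wallis_ratio_0, exp_0; simpl.
  replace (/ (1 * (2 * 0 + 1))) with 1 by field.
  unfold wallis_integral; apply is_RInt_unique.
  assert (V : minus (- cos (PI / 2)) (- cos 0) = 1).
  { rewrite cos_PI2, cos_0; unfold minus, plus, opp; simpl; ring. }
  rewrite <- V; apply (is_RInt_derive (fun t => - cos t)).
  + intros t _; auto_derive; [trivial|simpl; ring].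
  + intros t _; apply (ex_derive_continuous (fun t => sin t ^ 1)); auto_derive; trivial.
- assert (P := pos_INR n).
  assert (R := wallis_integral_rec (2 * n + 1)).
  rewrite IH, !plus_INR, mult_INR in R.
  change (INR 2) with 2 in R; change (INR 1) with 1 in R.
  replace (2 * S n + 1)%nat with (2 * n + 1 + 2)%nat by lia.
  rewrite log_wallis_ratio_succ, S_INR.
  assert (E := exp_pos (log_wallis_ratio n)).
  apply Rmult_eq_reg_l with (2 * INR n + 1 + 2); [|lra].
  rewrite R; field; lra.
Qed.

(** The integrals of index [2n], [2n+1], [2n+2] decrease. With [r = PI n c^2] the second comparison
    gives [r <= 1] and the first [1/r <= 1 + 1/n]; [ln y <= y - 1] turns both into the claim. *)
Lemma wallis_bounds (n : nat) : (0 < n)%nat ->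
  - / INR n <= 2 * log_wallis_ratio n + ln (INR n) + ln PI <= 0.
Proof.
intros Hn.
assert (P2 := PI2_1).
assert (Pn : 0 < INR n) by (apply lt_0_INR; lia).
assert (E := exp_pos (log_wallis_ratio n)). set (c := exp (log_wallis_ratio n)) in *.
assert (Ec : exp (2 * log_wallis_ratio n) = c * c).
{ unfold c; rewrite <- exp_plus; f_equal; ring. }
assert (D1 := wallis_integral_decr (2 * n)). assert (D2 := wallis_integral_decr (2 * n + 1)).
replace (S (2 * n)) with (2 * n + 1)%nat in D1 by lia.
replace (S (2 * n + 1)) with (2 * S n)%nat in D2 by lia.
rewrite wallis_integral_odd, wallis_integral_even in D1.
rewrite wallis_integral_odd, wallis_integral_even, log_wallis_ratio_succ in D2.
fold c in D1, D2.
set (r := PI * INR n * (c * c)).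
assert (c2 : 0 < c * c) by nra.
assert (r0 : 0 < r) by (unfold r; apply Rmult_lt_0_compat; [apply Rmult_lt_0_compat|]; lra).
assert (Er : ln r = 2 * log_wallis_ratio n + ln (INR n) + ln PI).
{ unfold r; rewrite ln_mult, ln_mult, <- Ec, ln_exp by nra; ring. }
rewrite <- Er.
assert (U : r <= 1).
{ apply Rmult_le_compat_r with (r := c * (2 * INR n + 1)) in D2; [|nra].
  rewrite Rinv_l in D2 by nra.
  replace (c * ((1 / 2 + INR n) / (1 + INR n)) * (PI / 2) * (c * (2 * INR n + 1)))
    with (r * ((2 * INR n + 1) * (2 * INR n + 1) / (4 * INR n * (1 + INR n)))) in D2
    by (unfold r; field; lra).
  assert (1 <= (2 * INR n + 1) * (2 * INR n + 1) / (4 * INR n * (1 + INR n))).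
  { apply Rmult_le_reg_r with (4 * INR n * (1 + INR n)); [nra|].
    replace ((2 * INR n + 1) * (2 * INR n + 1) / (4 * INR n * (1 + INR n))
      * (4 * INR n * (1 + INR n))) with ((2 * INR n + 1) * (2 * INR n + 1)) by (field; lra).
    nra. }
  nra. }
assert (L : / r <= 1 + / INR n).
{ apply Rmult_le_compat_r with (r := c * (2 * INR n + 1)) in D1; [|nra].
  rewrite Rinv_l in D1 by nra.
  apply Rmult_le_reg_r with r; [exact r0|]; rewrite Rinv_l by lra.
  replace ((1 + / INR n) * r) with (PI * (INR n + 1) * (c * c)) by (unfold r; field; lra).
  apply Rle_trans with (1 := D1).
  assert (0 < PI * (c * c)) by (apply Rmult_lt_0_compat; lra). nra. }
assert (A := ln_le_sub1 r r0). assert (B := ln_le_sub1 (/ r) (Rinv_0_lt_compat _ r0)).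
rewrite ln_Rinv in B by exact r0; lra.
Qed.

Lemma is_lim_seq_wallis :
  is_lim_seq (fun n => 2 * log_wallis_ratio n + ln (INR n)) (- ln PI).
Proof.
apply is_lim_seq_ext with (fun n => (2 * log_wallis_ratio n + ln (INR n) + ln PI) - ln PI).
{ intros n; ring. }
replace (Finite (- ln PI)) with (Finite (0 - ln PI)) by (f_equal; ring).
apply is_lim_seq_minus'; [|apply is_lim_seq_const].
apply is_lim_seq_le_le_loc with (fun n => -1 / INR n) (fun _ => 0).
- exists 1%nat; intros n Hn; assert (B := wallis_bounds n Hn); unfold Rdiv; lra.
- apply is_lim_seq_div_INR.
- apply is_lim_seq_const.
Qed.

(** Splits [(1/2)_(2n)] into factors of even and odd index, which trades the product for [3/4]
    against the one for [1/4] and Wallis's. *)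
Lemma lpoch_half_double (n : nat) :
  lpoch (1 / 2) (2 * n) = lpoch (1 / 4) n + lpoch (3 / 4) n + 2 * INR n * ln 2.
Proof.
unfold lpoch; induction n as [|n IH]; [simpl; ring|].
replace (2 * S n)%nat with (S (S (2 * n))) by lia.
cbn [bsum]; rewrite IH, !S_INR, mult_INR; change (INR 2) with 2.
assert (P := pos_INR n).
replace (1 / 2 + 2 * INR n) with (2 * (1 / 4 + INR n)) by field.
replace (1 / 2 + (2 * INR n + 1)) with (2 * (3 / 4 + INR n)) by field.
rewrite !ln_mult by lra; ring.
Qed.

Lemma lpoch_1_double (n : nat) :
  lpoch 1 (2 * n) = lpoch (1 / 2) n + lpoch 1 n + 2 * INR n * ln 2.
Proof.
unfold lpoch; induction n as [|n IH]; [simpl; ring|].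
replace (2 * S n)%nat with (S (S (2 * n))) by lia.
cbn [bsum]; rewrite IH, !S_INR, mult_INR; change (INR 2) with 2.
assert (P := pos_INR n).
replace (1 + 2 * INR n) with (2 * (1 / 2 + INR n)) by field.
replace (1 + (2 * INR n + 1)) with (2 * (1 + INR n)) by field.
rewrite !ln_mult by lra; ring.
Qed.

Lemma is_lim_seq_ln_shift (x : R) : 0 < x ->
  is_lim_seq (fun n => ln (INR n + x) - ln (INR n)) 0.
Proof.
intros Hx.
apply is_lim_seq_le_le_loc with (fun _ => 0) (fun n => x / INR n).
- exists 1%nat; intros n Hn.
  assert (Pn : 0 < INR n) by (apply lt_0_INR; lia).
  assert (ln (INR n) <= ln (INR n + x)) by (apply ln_le; lra).
  assert (C := ln_le_sub1 ((INR n + x) / INR n) ltac:(apply Rdiv_lt_0_compat; lra)).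
  rewrite ln_div in C by lra.
  replace ((INR n + x) / INR n - 1) with (x / INR n) in C by (field; lra); lra.
- apply is_lim_seq_const.
- apply is_lim_seq_div_INR.
Qed.

(** In Pochhammer symbols, the square of [(3/4)_M / (1/4)_M] equals the product of the squares of
    [(1/2)_(2M) / (2M)!] and [(1/2)_M / M!] and the fourth power of [M! / (1/4)_M]: two Wallis
    limits and Gauss's product four times. The powers of [M] combine with [ln(2 PI (M + 1/4))]. *)
Lemma is_lim_seq_jump_log_sum (v : R) : is_Gamma (1 / 4) v ->
  is_lim_seq (fun M => 2 * bsum (fun i => ln (INR i + 3 / 4) - ln (INR i + 1 / 4)) M
     - ln (2 * PI * (INR M + 1 / 4))) (4 * ln v - 3 * ln PI - 2 * ln 2).
Proof.
intros Hv.
assert (P2 := PI2_1).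
apply is_lim_seq_ext_loc with (fun M =>
   (2 * log_wallis_ratio (2 * M) + ln (INR (2 * M))) + (2 * log_wallis_ratio M + ln (INR M))
   - 4 * (lpoch (1 / 4) M - lpoch 1 M + (1 - 1 / 4) * ln (INR M))
   - (ln (INR M + 1 / 4) - ln (INR M)) - (2 * ln 2 + ln PI)).
{ exists 1%nat; intros M HM.
  assert (PM : 0 < INR M) by (apply lt_0_INR; lia).
  replace (bsum (fun i => ln (INR i + 3 / 4) - ln (INR i + 1 / 4)) M)
    with (lpoch (3 / 4) M - lpoch (1 / 4) M).
  2:{ unfold lpoch; clear; induction M as [|M IH]; simpl; [ring|].
      rewrite <- IH, (Rplus_comm (INR M)), (Rplus_comm (INR M)); ring. }
  unfold log_wallis_ratio; rewrite lpoch_half_double, lpoch_1_double.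
  rewrite mult_INR, !ln_mult by (try change (INR 2) with 2; lra).
  change (INR 2) with 2; field. }
replace (4 * ln v - 3 * ln PI - 2 * ln 2)
  with (- ln PI + - ln PI - 4 * (- ln v) - 0 - (2 * ln 2 + ln PI)) by ring.
apply is_lim_seq_minus'; [|apply is_lim_seq_const].
apply is_lim_seq_minus'; [|apply is_lim_seq_ln_shift; lra].
apply is_lim_seq_minus'; [apply is_lim_seq_plus'|].
- apply (is_lim_seq_subseq_double _ _ is_lim_seq_wallis).
- exact is_lim_seq_wallis.
- apply (is_lim_seq_scal_l _ 4 (- ln v)), is_lim_seq_gauss_product; [lra|exact Hv].
Qed.

(** * Expansion of the zeta difference at 1 *)

(* Taylor remainder of order one in [h] of [x ^ -(1 + h)]. *)
Definition power_remainder (h x : R) : R :=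
  Rpower x (- (1 + h)) - / x + h * (ln x / x).

Lemma power_remainder_eq (h x : R) : 0 < x ->
  power_remainder h x = (exp (- (h * ln x)) - 1 + h * ln x) / x.
Proof.
intros Hx; unfold power_remainder, Rpower.
replace (- (1 + h) * ln x) with (- (h * ln x) + - ln x) by ring.
rewrite exp_plus, (exp_Ropp (ln x)), exp_ln by exact Hx; field; lra.
Qed.

Lemma exp_opp_taylor (y : R) : 0 <= y -> 0 <= exp (- y) - 1 + y <= y ^ 2 / 2.
Proof.
intros Hy; split; [assert (H := exp_ineq1_le (- y)); lra|].
cut ((exp (- y) + y) - (exp (- 0) + 0) <= y ^ 2 / 2 - 0 ^ 2 / 2).
{ rewrite Ropp_0, exp_0; lra. }
apply (increment_le (fun y => exp (- y) + y) (fun y => y ^ 2 / 2)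
  (fun y => 1 - exp (- y)) (fun y => y)).
- exact Hy.
- intros; auto_derive; [trivial|ring].
- intros; auto_derive; [trivial|field].
- intros; apply (ex_derive_continuous (fun y => exp (- y) + y)); auto_derive; trivial.
- intros; apply (ex_derive_continuous (fun y => y ^ 2 / 2)); auto_derive; trivial.
- intros t _; assert (H := exp_ineq1_le (- t)); lra.
Qed.

(* Up to the factor [h^2], an increasing bounded primitive dominating the derivative of
   [power_remainder h] on [[1, +oo)], which makes the sum of its variations telescope. *)
Definition log_sqr_primitive (x : R) : R := - ((ln x) ^ 2 / 2 + 2 * ln x + 2) / x.

Lemma is_derive_log_sqr_primitive (x : R) : 0 < x ->
  is_derive log_sqr_primitive x (((ln x) ^ 2 / 2 + ln x) / x ^ 2).
Proof. intros Hx; unfold log_sqr_primitive; auto_derive; [lra|field; lra]. Qed.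

Lemma ln_ge_0 (x : R) : 1 <= x -> 0 <= ln x.
Proof. intros H; rewrite <- ln_1; apply ln_le; lra. Qed.

Lemma log_sqr_primitive_incr (a b : R) : 1 <= a <= b ->
  log_sqr_primitive a <= log_sqr_primitive b.
Proof.
intros H.
cut (0 - 0 <= log_sqr_primitive b - log_sqr_primitive a); [lra|].
apply (increment_le (fun _ => 0) log_sqr_primitive (fun _ => 0)
  (fun x => ((ln x) ^ 2 / 2 + ln x) / x ^ 2)).
- lra.
- intros; apply (is_derive_const 0).
- intros; apply is_derive_log_sqr_primitive; lra.
- intros; apply continuous_const.
- intros; eapply continuous_of_derive, is_derive_log_sqr_primitive; lra.
- intros t Ht; assert (L := ln_ge_0 t ltac:(lra)); apply Rdiv_le_0_compat; nra.
Qed.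

(** The numerator of the derivative is a difference of two nonnegative quantities, at most
    [h^2 ln x] and [h^2 (ln x)^2 / 2], whence the shape of [log_sqr_primitive]. *)
Lemma power_remainder_variation (h a b : R) : 0 < h -> 1 <= a <= b ->
  Rabs (power_remainder h b - power_remainder h a)
  <= h ^ 2 * (log_sqr_primitive b - log_sqr_primitive a).
Proof.
intros Hh Hab.
set (E := fun x => exp (- (h * ln x))).
assert (D : forall x, 0 < x -> is_derive (power_remainder h) x
  ((h * (1 - E x) - (E x - 1 + h * ln x)) / x ^ 2)).
{ intros x Hx.
  apply is_derive_ext_loc with (fun x => (exp (- (h * ln x)) - 1 + h * ln x) / x).
  - exists (mkposreal x Hx); intros y Hy; change (Rabs (y - x) < x) in Hy.
    apply Rabs_lt_between in Hy; symmetry; apply power_remainder_eq; lra.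
  - unfold E; auto_derive; [lra|field; lra]. }
rewrite Rmult_minus_distr_l.
assert (D2 : forall x, 0 < x -> is_derive (fun x => h ^ 2 * log_sqr_primitive x) x
   (h ^ 2 * (((ln x) ^ 2 / 2 + ln x) / x ^ 2))).
{ intros x Hx; apply (is_derive_scal log_sqr_primitive), is_derive_log_sqr_primitive, Hx. }
apply (increment_abs_le (power_remainder h) (fun x => h ^ 2 * log_sqr_primitive x)
  (fun x => (h * (1 - E x) - (E x - 1 + h * ln x)) / x ^ 2)
  (fun x => h ^ 2 * (((ln x) ^ 2 / 2 + ln x) / x ^ 2))).
- lra.
- intros; apply D; lra.
- intros; apply D2; lra.
- intros; eapply continuous_of_derive, D; lra.
- intros; eapply continuous_of_derive, D2; lra.
- intros x Hx; unfold Rdiv at 1 2; rewrite Rabs_mult, (Rabs_pos_eq (/ _)).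
  2:{ left; apply Rinv_0_lt_compat; nra. }
  rewrite <- Rmult_assoc; apply Rmult_le_compat_r; [left; apply Rinv_0_lt_compat; nra|].
  assert (L := ln_ge_0 x ltac:(lra)).
  assert (T := exp_opp_taylor (h * ln x) ltac:(nra)). fold (E x) in T.
  assert (E1 : E x <= 1).
  { unfold E; rewrite exp_Ropp, <- Rinv_1; apply Rinv_le_contravar; [lra|].
    assert (Q := exp_ineq1_le (h * ln x)); nra. }
  assert (h * (1 - E x) <= h * (h * ln x)) by (apply Rmult_le_compat_l; lra).
  assert (0 <= h * (1 - E x)) by nra.
  apply Rabs_le; nra.
Qed.

(** Serves the term [n = 0], whose points lie below 1. There [y = - h ln x] satisfies
    [y <= 3h <= 1/2], hence [exp y - 1 - y <= 2 y^2 <= 18 h^2], and [1/x <= 4]. *)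
Lemma power_remainder_small (h x : R) : 0 < h <= 1 / 6 -> 1 / 4 <= x <= 1 ->
  Rabs (power_remainder h x) <= 72 * h ^ 2.
Proof.
intros Hh Hx.
rewrite power_remainder_eq by lra.
assert (L := ln_le_sub1 (/ x) ltac:(apply Rinv_0_lt_compat; lra)).
rewrite ln_Rinv in L by lra.
assert (I : / x <= 4).
{ replace 4 with (/ (1 / 4)) by field; apply Rinv_le_contravar; lra. }
assert (L0 : ln x <= 0) by (rewrite <- ln_1; apply ln_le; lra).
set (y := - (h * ln x)).
replace (h * ln x) with (- y) by (unfold y; ring).
assert (Hy : 0 <= y <= 3 * h) by (unfold y; nra).
assert (P := exp_pos y).
assert (E1 : 1 + y <= exp y) by apply exp_ineq1_le.
assert (E2 : exp y * (1 - y) <= 1).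
{ apply Rle_trans with (exp y * exp (- y)).
  - apply Rmult_le_compat_l; [lra|assert (H := exp_ineq1_le (- y)); lra].
  - rewrite <- exp_plus, Rplus_opp_r, exp_0; lra. }
assert (E3 : exp y - 1 - y <= 2 * y ^ 2) by nra.
unfold Rdiv; rewrite Rabs_pos_eq.
- assert (0 < / x) by (apply Rinv_0_lt_compat; lra).
  apply Rle_trans with (2 * y ^ 2 * 4); [apply Rmult_le_compat; nra|nra].
- apply Rmult_le_pos; [lra|left; apply Rinv_0_lt_compat; lra].
Qed.

(** The term [n = 0] costs twice 72. For [n >= 1] the intervals [[n + 1/4, n + 3/4]] are disjoint,
    so the variations are bounded by the growth of [log_sqr_primitive] from its value [-2] at 1 to
    at most 0. Together [144 + 2]. *)
Lemma power_remainder_sum (h : R) (N : nat) : 0 < h <= 1 / 6 ->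
  Rabs (bsum (fun n => power_remainder h (INR n + 1 / 4) - power_remainder h (INR n + 3 / 4)) (S N))
  <= 146 * h ^ 2.
Proof.
intros Hh.
assert (T : forall N, Rabs (bsum
  (fun n => power_remainder h (INR n + 1 / 4) - power_remainder h (INR n + 3 / 4)) (S N))
  <= 144 * h ^ 2 + h ^ 2 * (log_sqr_primitive (INR (S N) + 1 / 4) - log_sqr_primitive 1)).
{ clear N; induction N as [|N IH].
  - simpl bsum; simpl INR.
    assert (A := power_remainder_small h (0 + 1 / 4) Hh ltac:(lra)).
    assert (B := power_remainder_small h (0 + 3 / 4) Hh ltac:(lra)).
    assert (C := log_sqr_primitive_incr 1 (1 + 1 / 4) ltac:(lra)).
    assert (0 <= h ^ 2 * (log_sqr_primitive (1 + 1 / 4) - log_sqr_primitive 1))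
      by (apply Rmult_le_pos; [apply pow2_ge_0|lra]).
    apply Rabs_le_between in A, B; apply Rabs_le; lra.
  - change (bsum (fun n => power_remainder h (INR n + 1 / 4)
       - power_remainder h (INR n + 3 / 4)) (S (S N))) with
     (bsum (fun n => power_remainder h (INR n + 1 / 4)
       - power_remainder h (INR n + 3 / 4)) (S N) +
      (power_remainder h (INR (S N) + 1 / 4) - power_remainder h (INR (S N) + 3 / 4))).
    assert (P : 1 <= INR (S N)) by (apply (le_INR 1); lia).
    rewrite (S_INR (S N)); set (m := INR (S N)) in *.
    assert (V := power_remainder_variation h (m + 1 / 4) (m + 3 / 4) ltac:(lra) ltac:(lra)).
    assert (C := log_sqr_primitive_incr (m + 3 / 4) (m + 1 + 1 / 4) ltac:(lra)).
    assert (h ^ 2 * (log_sqr_primitive (m + 3 / 4) - log_sqr_primitive (m + 1 / 4))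
      <= h ^ 2 * (log_sqr_primitive (m + 1 + 1 / 4) - log_sqr_primitive (m + 1 / 4)))
      by (apply Rmult_le_compat_l; [apply pow2_ge_0|lra]).
    apply Rabs_le_between in V, IH; apply Rabs_le; lra. }
eapply Rle_trans; [apply T|].
assert (Q : log_sqr_primitive (INR (S N) + 1 / 4) <= 0).
{ unfold log_sqr_primitive.
  assert (P := INR_S_pos N). assert (1 <= INR (S N)) by (apply (le_INR 1); lia).
  assert (L := ln_ge_0 (INR (S N) + 1 / 4) ltac:(lra)).
  rewrite Rdiv_opp_l; apply Ropp_le_cancel; rewrite Ropp_involutive, Ropp_0.
  apply Rdiv_le_0_compat; nra. }
replace (log_sqr_primitive 1) with (-2).
2:{ unfold log_sqr_primitive; rewrite ln_1; field. }
assert (P := pow2_ge_0 h); nra.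
Qed.

Lemma sum_inv_quarters (N : nat) :
  bsum (fun n => / (INR n + 1 / 4) - / (INR n + 3 / 4)) N = 4 * square_wave_sum (2 * N) 0.
Proof.
unfold square_wave_sum; induction N as [|N IH]; [simpl; ring|].
replace (2 * S N)%nat with (S (S (2 * N))) by lia.
cbn [bsum]; rewrite IH, pow_1_odd, pow_1_even, !Rmult_0_r, cos_0.
replace (INR (2 * S (2 * N) + 1)) with (4 * (INR N + 3 / 4)).
2:{ replace (2 * S (2 * N) + 1)%nat with (4 * N + 3)%nat by lia.
    rewrite plus_INR, mult_INR; simpl INR; field. }
replace (INR (2 * (2 * N) + 1)) with (4 * (INR N + 1 / 4)).
2:{ rewrite plus_INR, !mult_INR; simpl INR; field. }
assert (P := pos_INR N); field; lra.
Qed.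

Lemma sum_log_quarters (N : nat) :
  bsum (fun n => ln (INR n + 1 / 4) / (INR n + 1 / 4) - ln (INR n + 3 / 4) / (INR n + 3 / 4)) N
  = 4 * beta_log_sum (2 * N) - 8 * ln 2 * square_wave_sum (2 * N) 0.
Proof.
unfold beta_log_sum, square_wave_sum; induction N as [|N IH]; [simpl; ring|].
replace (2 * S N)%nat with (S (S (2 * N))) by lia.
cbn [bsum]; rewrite IH, pow_1_odd, pow_1_even, !Rmult_0_r, cos_0.
(* The factor 4 is written [2 * 2] so that its logarithm splits into [2 ln 2]. *)
replace (INR (2 * S (2 * N) + 1)) with (2 * 2 * (INR N + 3 / 4)).
2:{ replace (2 * S (2 * N) + 1)%nat with (4 * N + 3)%nat by lia.
    rewrite plus_INR, mult_INR; simpl INR; field. }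
replace (INR (2 * (2 * N) + 1)) with (2 * 2 * (INR N + 1 / 4)).
2:{ rewrite plus_INR, !mult_INR; simpl INR; field. }
assert (P := pos_INR N); rewrite !ln_mult by lra; field; lra.
Qed.

(** The remainders sum to [D] minus its first-order part, whose coefficients are [4 (PI/4) = PI] and
    [-(4 l - 8 ln 2 (PI/4))]. The bound is uniform in the number of terms and passes to the
    limit. *)
Lemma zeta_difference_expansion (l D h : R) :
  is_lim_seq beta_log_sum l -> 0 < h <= 1 / 6 ->
  is_lim_seq (bsum (fun n => Rpower (INR n + 1 / 4) (- (1 + h))
                            - Rpower (INR n + 3 / 4) (- (1 + h)))) D ->
  Rabs (D - PI - (2 * PI * ln 2 - 4 * l) * h) <= 146 * h ^ 2.
Proof.
intros Hl Hh HD.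
assert (L : is_lim_seq (fun N => bsum (fun n => power_remainder h (INR n + 1 / 4)
    - power_remainder h (INR n + 3 / 4)) N)
  (D - 4 * (PI / 4) + h * (4 * l - 8 * ln 2 * (PI / 4)))).
{ apply is_lim_seq_ext with (fun N => bsum (fun n => Rpower (INR n + 1 / 4) (- (1 + h))
       - Rpower (INR n + 3 / 4) (- (1 + h))) N - 4 * square_wave_sum (2 * N) 0
    + h * (4 * beta_log_sum (2 * N) - 8 * ln 2 * square_wave_sum (2 * N) 0)).
  { intros N; rewrite <- sum_inv_quarters, <- sum_log_quarters.
    unfold power_remainder; clear; induction N as [|N IH]; cbn [bsum]; [ring|].
    rewrite <- IH; ring. }
  assert (Q := is_lim_seq_subseq_double _ _ is_lim_seq_leibniz).
  assert (B := is_lim_seq_subseq_double _ _ Hl).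
  apply is_lim_seq_plus'; [apply is_lim_seq_minus'; [exact HD|]|].
  - apply (is_lim_seq_scal_l _ 4 (PI / 4)), Q.
  - apply (is_lim_seq_scal_l _ h (4 * l - 8 * ln 2 * (PI / 4))), is_lim_seq_minus'.
    + apply (is_lim_seq_scal_l _ 4 l), B.
    + apply (is_lim_seq_scal_l _ (8 * ln 2) (PI / 4)), Q. }
replace (D - PI - (2 * PI * ln 2 - 4 * l) * h)
  with (D - 4 * (PI / 4) + h * (4 * l - 8 * ln 2 * (PI / 4))) by field.
apply is_lim_seq_abs in L.
apply (is_lim_seq_le_loc _ (fun _ => 146 * h ^ 2)
  (Rabs (D - 4 * (PI / 4) + h * (4 * l - 8 * ln 2 * (PI / 4)))) (146 * h ^ 2))
  with (2 := L) (3 := is_lim_seq_const _).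
exists 1%nat; intros [|N] HN; [lia|]; apply power_remainder_sum, Hh.
Qed.

(** * From Laurent coefficients to real series *)

Lemma is_series_Re (a : nat -> C) (l : C) :
  is_series (K := C_AbsRing) (V := C_NormedModule) a l -> is_series (fun n => Re (a n)) (Re l).
Proof.
intros H; unfold is_series in *.
apply filterlim_ext with (fun n => Re (sum_n a n)).
{ intros n; induction n as [|n IH]; [now rewrite !sum_O|].
  rewrite !sum_Sn, <- IH; reflexivity. }
apply filterlim_comp with (1 := H).
destruct l as [x y]; apply (continuous_fst (U := R_UniformSpace) (V := R_UniformSpace)).
Qed.

Lemma is_series_Im (a : nat -> C) (l : C) :
  is_series (K := C_AbsRing) (V := C_NormedModule) a l -> is_series (fun n => Im (a n)) (Im l).
Proof.
intros H; unfold is_series in *.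
apply filterlim_ext with (fun n => Im (sum_n a n)).
{ intros n; induction n as [|n IH]; [now rewrite !sum_O|].
  rewrite !sum_Sn, <- IH; reflexivity. }
apply filterlim_comp with (1 := H).
destruct l as [x y]; apply (continuous_snd (U := R_UniformSpace) (V := R_UniformSpace)).
Qed.

Lemma Rcpow_real (a s : R) : Rcpow a (Copp (RtoC s)) = RtoC (Rpower a (- s)).
Proof.
unfold Rcpow, Cexp, Rpower; simpl.
replace (- s * 0 + -0 * ln a) with 0 by ring.
replace (- s * ln a - -0 * 0) with (- s * ln a) by ring.
rewrite cos_0, sin_0, Rmult_1_r, Rmult_0_r; reflexivity.
Qed.

Lemma hurwitz_zeta_real (u : R) (Z : C -> C) (h : R) : is_hurwitz_zeta u Z -> 0 < h ->
  is_series (fun n => Rpower (INR n + u) (- (1 + h))) (Re (Z (RtoC (1 + h)))) /\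
  Im (Z (RtoC (1 + h))) = 0.
Proof.
intros [HZ _] Hh.
specialize (HZ (RtoC (1 + h)) ltac:(simpl; lra)).
split.
- apply is_series_Re in HZ; apply is_series_ext with (2 := HZ).
  intros n; rewrite Rcpow_real; reflexivity.
- apply is_series_Im in HZ.
  assert (E : is_series (fun _ => 0) (Im (Z (RtoC (1 + h))))).
  { apply is_series_ext with (2 := HZ); intros n; rewrite Rcpow_real; reflexivity. }
  apply is_series_unique in E; rewrite <- E.
  apply is_series_unique.
  change (is_lim_seq (sum_n (fun _ => 0)) 0).
  apply is_lim_seq_ext with (fun _ => 0); [|apply is_lim_seq_const].
  intros n; rewrite sum_n_const; ring.
Qed.

Lemma pow_n_RtoC (h : R) (k : nat) : pow_n (K := C_Ring) (RtoC h) k = RtoC (h ^ k).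
Proof.
induction k as [|k IH]; [reflexivity|].
simpl pow_n; rewrite IH; simpl pow; rewrite RtoC_mult; reflexivity.
Qed.

Definition laurent_coeff (p : nat) : R := (-1) ^ p / INR (fact p).

Lemma stieltjes_expansion_real (Z : C -> C) (g : nat -> C) : is_stieltjes_expansion Z g ->
  exists r, 0 < r /\ forall h, 0 < h < r ->
    is_pseries (fun p => laurent_coeff p * Re (g p)) h (Re (Z (RtoC (1 + h))) - / h) /\
    is_pseries (fun p => laurent_coeff p * Im (g p)) h (Im (Z (RtoC (1 + h)))).
Proof.
intros (r & r0 & H); exists r; split; [exact r0|]; intros h Hh.
specialize (H (RtoC (1 + h))).
assert (E : Cminus (RtoC (1 + h)) (RtoC 1) = RtoC h).
{ rewrite <- RtoC_minus; f_equal; ring. }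
rewrite E, Cmod_R, Rabs_pos_eq, <- RtoC_div in H by lra.
specialize (H ltac:(lra)).
assert (T : forall k, scal (K := C_Ring) (V := C_ModuleSpace) (pow_n (K := C_Ring) (RtoC h) k)
  (Cmult (RtoC ((-1) ^ k / INR (fact k))) (g k))
  = Cmult (RtoC (laurent_coeff k * h ^ k)) (g k)).
{ intros k; rewrite pow_n_RtoC; unfold scal; simpl.
  unfold laurent_coeff; rewrite RtoC_mult; unfold mult; simpl; ring. }
split; apply is_pseries_R.
- apply is_series_Re in H.
  replace (Re (Z (RtoC (1 + h))) - / h)
    with (Re (Cminus (Z (RtoC (1 + h))) (RtoC (1 / h)))) by (simpl; unfold Re; field; lra).
  apply is_series_ext with (2 := H); intros k.
  refine (eq_trans (f_equal Re (T k)) _); rewrite re_scal_l; unfold AbsRing.sort; simpl; ring.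
- apply is_series_Im in H.
  replace (Im (Z (RtoC (1 + h))))
    with (Im (Cminus (Z (RtoC (1 + h))) (RtoC (1 / h)))) by (simpl; unfold Im; ring).
  apply is_series_ext with (2 := H); intros k.
  refine (eq_trans (f_equal Im (T k)) _); rewrite im_scal_l; unfold AbsRing.sort; simpl; ring.
Qed.

Lemma CV_radius_pos (a : nat -> R) (x l : R) : 0 < x -> is_pseries a x l ->
  Rbar_lt 0 (CV_radius a).
Proof.
intros Hx H.
apply Rbar_lt_le_trans with x; [exact Hx|].
apply Rbar_not_lt_le; intros N.
apply (CV_disk_outside a x); [now rewrite Rabs_pos_eq by lra|].
apply is_pseries_R in H.
apply ex_series_lim_0; exists l; exact H.
Qed.

(** The power series has positive radius of convergence, so it is differentiable at 0 with
    derivative [a 1]. Although the estimate holds only for [h > 0], continuity yields [f 0 = 0], and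
    the right difference quotient then yields [f'(0) = 0]. *)
Lemma pseries_coeff_1_unique (a : nat -> R) (D : R -> R) (r c0 c1 C : R) :
  0 < r -> (forall h, 0 < h < r -> is_pseries a h (D h)) ->
  (forall h, 0 < h < r -> Rabs (D h - c0 - c1 * h) <= C * h ^ 2) -> a 1%nat = c1.
Proof.
intros Hr HD HC.
assert (Rad := CV_radius_pos a (r / 2) _ ltac:(lra) (HD (r / 2) ltac:(lra))).
assert (Rad0 : Rbar_lt (Rabs 0) (CV_radius a)) by (rewrite Rabs_R0; exact Rad).
assert (dP : is_derive (PSeries a) 0 (a 1%nat)).
{ replace (a 1%nat) with (Derive (PSeries a) 0).
  - apply Derive_correct, ex_derive_PSeries, Rad0.
  - rewrite Derive_PSeries by exact Rad0.
    rewrite PSeries_0; unfold PS_derive; simpl; ring. }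
set (f := fun h => PSeries a h - c0 - c1 * h).
assert (df : is_derive f 0 (a 1%nat - c1)).
{ replace (a 1%nat - c1) with (a 1%nat - 0 - c1) by ring.
  apply (is_derive_minus (fun h => PSeries a h - c0) (fun h => c1 * h)).
  - apply (is_derive_minus (PSeries a) (fun _ => c0)); [exact dP|apply (is_derive_const c0)].
  - auto_derive; [trivial|ring]. }
assert (Bf : forall h, 0 < h < r -> Rabs (f h) <= Rabs C * h ^ 2).
{ intros h Hh; unfold f; rewrite (is_pseries_unique _ _ _ (HD h Hh)).
  apply Rle_trans with (1 := HC h Hh).
  apply Rmult_le_compat_r; [apply pow2_ge_0|apply Rle_abs]. }
assert (C0 := Rabs_pos C).
assert (small : forall d, 0 < d -> exists h, 0 < h < r /\ h < d /\ h <= 1).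
{ intros d Hd; exists (Rmin (r / 2) (Rmin (d / 2) 1)).
  assert (0 < Rmin (r / 2) (Rmin (d / 2) 1)) by (repeat apply Rmin_glb_lt; lra).
  assert (A := Rmin_l (r / 2) (Rmin (d / 2) 1)). assert (B := Rmin_r (r / 2) (Rmin (d / 2) 1)).
  assert (A' := Rmin_l (d / 2) 1). assert (B' := Rmin_r (d / 2) 1). lra. }
assert (f0 : f 0 = 0).
{ apply Rabs_eq_0, Rle_antisym; [|apply Rabs_pos]; apply le_epsilon; intros e He.
  assert (Cf := continuous_of_derive _ _ _ df).
  apply filterlim_locally with (eps := mkposreal (e / 2) ltac:(lra)) in Cf.
  destruct Cf as [d Hd].
  (* This choice gives [|C| h^2 <= |C| h < e/2]; the [+ 1] keeps the denominator positive when
     [C = 0]. *)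
  destruct (small (Rmin d (e / (2 * (Rabs C + 1))))) as (h & Hh & Hhd & Hh1).
  { apply Rmin_glb_lt; [apply cond_pos|apply Rdiv_lt_0_compat; lra]. }
  assert (A := Rmin_l d (e / (2 * (Rabs C + 1)))).
  assert (B := Rmin_r d (e / (2 * (Rabs C + 1)))).
  specialize (Hd h); change (Rabs (h - 0) < d -> Rabs (f h - f 0) < e / 2) in Hd.
  rewrite Rminus_0_r, Rabs_pos_eq in Hd by lra; specialize (Hd ltac:(lra)).
  specialize (Bf h Hh).
  assert (h * (2 * (Rabs C + 1)) < e).
  { apply Rlt_le_trans with (e / (2 * (Rabs C + 1)) * (2 * (Rabs C + 1))).
    - apply Rmult_lt_compat_r; lra.
    - right; field; lra. }
  assert (Rabs C * h ^ 2 <= Rabs C * h) by (apply Rmult_le_compat_l; nra).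
  assert (T := Rabs_triang_inv (f 0) (f h)); rewrite Rabs_minus_sym in T.
  lra. }
apply Rminus_diag_uniq, Rabs_eq_0, Rle_antisym; [|apply Rabs_pos].
apply le_epsilon; intros e He.
apply is_derive_Reals in df.
destruct (df (e / 2) ltac:(lra)) as [d Hd].
destruct (small (Rmin d (e / (2 * (Rabs C + 1))))) as (h & Hh & Hhd & Hh1).
{ apply Rmin_glb_lt; [apply cond_pos|apply Rdiv_lt_0_compat; lra]. }
assert (A := Rmin_l d (e / (2 * (Rabs C + 1)))).
assert (B := Rmin_r d (e / (2 * (Rabs C + 1)))).
specialize (Hd h ltac:(lra)).
rewrite Rplus_0_l, f0, Rminus_0_r, Rabs_pos_eq in Hd by lra.
specialize (Hd ltac:(lra)); specialize (Bf h Hh).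
assert (h * (2 * (Rabs C + 1)) < e).
{ apply Rlt_le_trans with (e / (2 * (Rabs C + 1)) * (2 * (Rabs C + 1))).
  - apply Rmult_lt_compat_r; lra.
  - right; field; lra. }
assert (Q : Rabs (f h / h) <= Rabs C * h).
{ unfold Rdiv; rewrite Rabs_mult, (Rabs_pos_eq (/ h)) by (left; apply Rinv_0_lt_compat; lra).
  apply Rle_trans with (Rabs C * h ^ 2 * / h).
  - apply Rmult_le_compat_r; [left; apply Rinv_0_lt_compat; lra|exact Bf].
  - right; field; lra. }
assert (T := Rabs_triang_inv (a 1%nat - c1) (f h / h)); rewrite (Rabs_minus_sym (a 1%nat - c1)) in T.
assert (0 <= Rabs C * h) by nra.
lra.
Qed.

Lemma bsum_sum_n (f : nat -> R) (n : nat) : bsum f (S n) = sum_n f n.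
Proof.
induction n as [|n IH]; [rewrite sum_O; simpl; ring|].
rewrite sum_Sn, <- IH; reflexivity.
Qed.

Lemma is_lim_seq_bsum (f : nat -> R) (l : R) : is_series f l -> is_lim_seq (bsum f) l.
Proof.
intros H; apply is_lim_seq_incr_1.
apply is_lim_seq_ext with (sum_n f); [intros n; symmetry; apply bsum_sum_n|exact H].
Qed.

Theorem mainTheorem1 (gam : nat -> R -> C) (hgam : are_stieltjes_constants gam) :
  Cminus (gam 1%nat (1 / 4)) (gam 1%nat (3 / 4)) =
  RtoC (- PI * (euler_gamma + 4 * ln 2 + 3 * ln PI - 4 * ln (Gamma (1 / 4)))).
Proof.
destruct (hgam (1 / 4) ltac:(lra)) as (Z1 & HZ1 & HS1).
destruct (hgam (3 / 4) ltac:(lra)) as (Z3 & HZ3 & HS3).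
destruct (is_Gamma_ex (1 / 4) ltac:(lra)) as [v Hv].
assert (Ev : Gamma (1 / 4) = v) by (apply (is_RInt_gen_unique (gamma_kernel (1 / 4))), Hv).
rewrite Ev.
assert (Hl := is_lim_seq_beta_log_sum _ (is_lim_seq_jump_log_sum v Hv)).
destruct (stieltjes_expansion_real _ _ HS1) as (r1 & r1p & H1).
destruct (stieltjes_expansion_real _ _ HS3) as (r3 & r3p & H3).
set (r := Rmin (1 / 6) (Rmin r1 r3)).
assert (rp : 0 < r) by (unfold r; repeat apply Rmin_glb_lt; lra).
assert (R6 : r <= 1 / 6) by apply Rmin_l.
assert (R1 : r <= r1) by (eapply Rle_trans; [apply Rmin_r|apply Rmin_l]).
assert (R3 : r <= r3) by (eapply Rle_trans; [apply Rmin_r|apply Rmin_r]).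
set (l := PI / 4 * (4 * ln v - 3 * ln PI - 2 * ln 2 - euler_gamma)) in Hl.
assert (ReE := pseries_coeff_1_unique
  (PS_minus (fun p => laurent_coeff p * Re (gam p (1 / 4)))
            (fun p => laurent_coeff p * Re (gam p (3 / 4))))
  (fun h => Re (Z1 (RtoC (1 + h))) - Re (Z3 (RtoC (1 + h))))
  r PI (2 * PI * ln 2 - 4 * l) 146 rp).
(* Both zeta values are real at [1 + h], so the imaginary parts of the coefficients give a power
   series for the zero function. *)
assert (ImE := pseries_coeff_1_unique
  (PS_minus (fun p => laurent_coeff p * Im (gam p (1 / 4)))
            (fun p => laurent_coeff p * Im (gam p (3 / 4))))
  (fun _ => 0) r 0 0 0 rp).
lapply ReE; clear ReE; [intros ReE|].
2:{ intros h Hh.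
    (* The two poles [1/h] cancel in the difference. *)
    replace (Re (Z1 (RtoC (1 + h))) - Re (Z3 (RtoC (1 + h)))) with
      (plus (Re (Z1 (RtoC (1 + h))) - / h) (opp (Re (Z3 (RtoC (1 + h))) - / h)))
      by (unfold plus, opp; simpl; ring).
    apply (is_pseries_minus (K := R_AbsRing) (V := R_NormedModule)).
    - apply H1; lra.
    - apply H3; lra. }
lapply ReE; clear ReE; [intros ReE|].
2:{ intros h Hh; apply zeta_difference_expansion; [exact Hl|lra|].
    apply is_lim_seq_bsum.
    apply (is_series_minus (K := R_AbsRing) (V := R_NormedModule)).
    - apply (hurwitz_zeta_real _ _ h HZ1); lra.
    - apply (hurwitz_zeta_real _ _ h HZ3); lra. }
lapply ImE; clear ImE; [intros ImE|].
2:{ intros h Hh.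
    replace 0 with (plus (Im (Z1 (RtoC (1 + h)))) (opp (Im (Z3 (RtoC (1 + h)))))).
    - apply (is_pseries_minus (K := R_AbsRing) (V := R_NormedModule)).
      + apply H1; lra.
      + apply H3; lra.
    - rewrite (proj2 (hurwitz_zeta_real _ _ h HZ1 (proj1 Hh))).
      rewrite (proj2 (hurwitz_zeta_real _ _ h HZ3 (proj1 Hh))).
      unfold plus, opp; simpl; ring. }
lapply ImE; clear ImE; [intros ImE|].
2:{ intros h Hh; rewrite Rmult_0_l, !Rminus_0_r, Rabs_R0; lra. }
(* Since [laurent_coeff 1 = -1], the difference of the constants is [4 l - 2 PI ln 2]; the [-2 ln 2]
   inside [l] raises the coefficient of [ln 2] to 4. *)
unfold PS_minus, PS_plus, PS_opp, laurent_coeff, plus, opp in ReE, ImE; simpl in ReE, ImE.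
apply injective_projections; simpl.
- change (Re (gam 1%nat (1 / 4)) + - Re (gam 1%nat (3 / 4))
    = - PI * (euler_gamma + 4 * ln 2 + 3 * ln PI - 4 * ln v)).
  unfold l in ReE; lra.
- change (Im (gam 1%nat (1 / 4)) + - Im (gam 1%nat (3 / 4)) = 0).
  lra.
Qed.
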